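(* The information process $\beta$ is an $\mathbb F^0$-Markov process: for all $t\ge 0$, all $h\ge0$ and every measurable function $f:\mathbb R\to\mathbb R$ which is nonnegative or such that $f(\beta_{t+h})$ is integrable, $$\mathbf E\left[f(\beta_{t+h})\,|\,\mathcal F^0_t\right]=\mathbf E\left[f(\beta_{t+h})\,|\,\beta_t\right],\quad \mathbf P\text{-a.s.}$$
   Context: Setting. $(\Omega,\mathcal F,\mathbf P)$ is a complete probability space. $W=(W_t)_{t\ge0}$ is a standard Brownian motion with continuous paths starting from $0$. $\tau:\Omega\to(0,\infty)$ is a strictly positive random variable. It is assumed throughout that $\tau$ and $W$ are independent and that $\tau$ is not a stopping time of the completed natural filtration of $W$ (so $\tau$ is not a.s. equal to a constant). The information process $\beta=(\beta_t)_{t\ge0}$ is $$\beta_t:=W_t-\frac{t}{\tau\vee t}W_{\tau\vee t},\quad t\ge0 ,$$ and $\mathbb F^0=(\mathcal F^0_t)_{t\ge0}$, $\mathcal F^0_t:=\sigma(\beta_s,\,0\le s\le t)$, is its natural filtration. *)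

(* Defs.v *)
From HB Require Import structures.
From mathcomp Require Import all_boot all_order all_algebra.
From mathcomp Require Import all_classical all_reals all_analysis.
From mathcomp Require Import measurable_realfun.

Set Implicit Arguments.
Unset Strict Implicit.
Unset Printing Implicit Defensive.

Import Order.TTheory GRing.Theory Num.Theory numFieldNormedType.Exports.

Local Open Scope classical_set_scope.
Local Open Scope ring_scope.

Section sigma_algebras.
Context {d : measure_display} {T : measurableType d} {R : realType}.

Definition sigma_rv {d' : measure_display} {T' : measurableType d'}
    (X : T -> T') : set (set T) :=
  preimage_set_system setT X measurable.

Definition sigma_process (D : set R) (X : R -> T -> R) : set (set T) :=
  <<s \bigcup_(s in D) sigma_rv (X s) >>.

Definition natural_filtration (X : R -> T -> R) (t : R) : set (set T) :=
  sigma_process `[0, t] X.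

Variable P : probability T R.

Definition completed_natural_filtration (X : R -> T -> R) (t : R) :
    set (set T) :=
  <<s natural_filtration X t `|` P.-negligible >>.

Definition stopping_time (F : R -> set (set T)) (tau : T -> R) : Prop :=
  forall t, 0 <= t -> F t [set w | tau w <= t].

Definition independent (G H : set (set T)) : Prop :=
  forall A B, G A -> H B -> P (A `&` B) = (P A * P B)%E.

(* The time index is R, but only the times t >= 0 are constrained.  The second
   argument of normal_prob is a standard deviation. *)
Record brownian_motion (W : R -> T -> R) : Prop := BrownianMotion {
  bm_measurable : forall t, 0 <= t -> measurable_fun setT (W t) ;
  bm_start : forall w, W 0 w = 0 ;
  bm_continuous : forall w, {within `[0, +oo[, continuous (W ^~ w)} ;
  bm_independent : forall s t, 0 <= s -> s < t ->
    independent (natural_filtration W s) (sigma_rv (W t \- W s)) ;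
  bm_normal : forall s t, 0 <= s -> s < t -> forall A, measurable A ->
    pushforward P (W t \- W s) A = normal_prob 0 (Num.sqrt (t - s)) A }.

(* No sign or integrability condition on Y is needed: for X nonnegative
   (resp. integrable), the identity on the sets [Y < 0] and [Y >= 0], which
   belong to G, forces Y to be a.s. nonnegative (resp. integrable). *)
Definition is_condexp (G : set (set T)) (X : T -> R) (Y : T -> \bar R) : Prop :=
  sigma_rv Y `<=` G /\
  (forall A, G A -> \int[P]_(w in A) Y w = \int[P]_(w in A) (X w)%:E)%E.

(* An arbitrary version of E[X | G]; condexpP below shows that the default
   value is irrelevant for X nonnegative or integrable. *)
Definition condexp (G : set (set T)) (X : T -> R) : T -> \bar R :=
  xget (cst 0%E) [set Y | is_condexp G X Y].

End sigma_algebras.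

Definition information_process {d : measure_display} {T : measurableType d}
    {R : realType} (tau : T -> R) (W : R -> T -> R) (t : R) (w : T) : R :=
  W t w - t / Num.max (tau w) t * W (Num.max (tau w) t) w.

Section condexp_exists.
Local Open Scope ereal_scope.
Context {d : measure_display} {T : measurableType d} {R : realType}.
Variables (P : probability T R) (G : set (set T)).
Hypotheses (sG : sigma_algebra setT G) (Gm : G `<=` measurable).

Let S := g_sigma_algebraType G.
Let p : T -> S := id.

Let mS (A : set S) : measurable A = G A.
Proof. by rewrite /measurable/= sigma_algebra_id. Qed.

Let mp : measurable_fun setT p.
Proof. by move=> _ B; rewrite mS setTI => GB; exact: Gm. Qed.

Let p_mixin := isMeasurableFun.Build _ _ T S p mp.
Let p_mfun : {mfun T >-> S} := HB.pack p p_mixin.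

Let Q : probability S R := distribution P p_mfun.

Section finite.
Variable X : T -> \bar R.
Hypotheses (X0 : forall w, 0 <= X w) (iX : P.-integrable setT X).

Let nu (A : set S) : \bar R := \int[P]_(w in A) X w.
Let nu0 : nu set0 = 0. Proof. by rewrite /nu integral_set0. Qed.
Let nu_ge0 A : 0 <= nu A. Proof. exact: integral_ge0. Qed.
Let nu_sa : semi_sigma_additive nu.
Proof.
move=> F mF tF mUF; apply: (semi_sigma_additive_nng_induced (mu := P)) => //.
- exact: measurable_int iX.
- by move=> i; have := mF i; rewrite mS; exact: Gm.
- by move: mUF; rewrite mS; exact: Gm.
Qed.
Let nu_mixin := isMeasure.Build _ S R nu nu0 nu_ge0 nu_sa.
Let nu_measure : {measure set S -> \bar R} := HB.pack nu nu_mixin.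
Let nu_fin : fin_num_fun nu.
Proof.
move=> A; rewrite mS => /Gm mA; apply: integrable_fin_num => //.
exact: integrableS iX.
Qed.
Let nu_finite_mixin := Measure_isFinite.Build _ S R nu_measure nu_fin.
Let nu_finite : {finite_measure set S -> \bar R} :=
  HB.pack nu nu_mixin nu_finite_mixin.

Lemma exists_condexp_finite : exists Y : S -> \bar R, [/\ measurable_fun setT Y,
  (forall w, 0 <= Y w) &
  forall A, G A -> \int[Q]_(w in A) Y w = \int[P]_(w in A) X w].
Proof.
have nuQ : nu_finite `<< Q.
  apply/null_content_dominatesP => A mA QA0.
  have GA : G A by rewrite -mS.
  apply: null_set_integral => //; first exact: Gm.
  exact/measurable_funTS/(measurable_int _ iX).
have [Y [Y0 _ iY nuE]] := radon_nikodym_sigma_finite nuQ.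
exists Y; split => //; first exact: measurable_int iY.
by move=> A GA; rewrite [RHS](nuE A)// mS.
Qed.

End finite.

Let exists_condexp_ge0 (X : T -> \bar R) :
  measurable_fun setT X -> (forall w, 0 <= X w) -> (forall w, X w < +oo) ->
  exists Y : S -> \bar R, [/\ measurable_fun setT Y, (forall w, 0 <= Y w) &
    forall A, G A -> \int[Q]_(w in A) Y w = \int[P]_(w in A) X w].
Proof.
move=> mX X0 Xoo.
pose F n := X @^-1` `[n%:R%:E, n.+1%:R%:E[.
have mF n : measurable (F n).
  by rewrite -[F n]setTI; apply: mX => //; exact: emeasurable_itv.
pose Xn n := X \_ (F n).
have mXn n : measurable_fun setT (Xn n).
  by apply/(measurable_restrictT _ (mF n)); exact: measurable_funTS.
have Xn0 n w : 0 <= Xn n w by exact: erestrict_ge0.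
have iXn n : P.-integrable setT (Xn n).
  apply: (@le_integrable _ _ _ _ _ _ _ (cst n.+1%:R%:E)) => //; last first.
    exact: finite_measure_integrable_cst.
  move=> w _; rewrite gee0_abs// /cst abse_EFin ger0_norm// /Xn patchE.
  case: ifPn => [|_]; last by rewrite lee_fin.
  by rewrite inE /F/= in_itv/= => /andP[_ /ltW].
have XE w : X w = \sum_(n <oo) Xn n w.
  have XwE : X w = (fine (X w))%:E by rewrite fineK// ge0_fin_numE.
  have x0 : (0 <= fine (X w))%R by exact: fine_ge0.
  pose m := Num.truncn (fine (X w)).
  have /andP[m1 m2] := truncn_itv x0.
  rewrite (nneseriesD1 (n := m))//= eseries0 ?adde0.
    by rewrite /Xn patchE mem_set// /F/= in_itv/= XwE lee_fin lte_fin m1.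
  move=> i _ im; rewrite /Xn patchE memNset// /F/= in_itv/= => /andP[].
  rewrite XwE lee_fin lte_fin => i1 i2; move/eqP: im; apply.
  by apply/esym/truncn_def; rewrite i1.
have /choice[Y /all_and3[mY Y0 YE]] n := exists_condexp_finite (Xn0 n) (iXn n).
exists (fun w => \sum_(n <oo) Y n w); split.
- by apply: ge0_emeasurable_sum.
- by move=> w; exact: nneseries_ge0.
move=> A GA; have mA : measurable A by exact: Gm.
have mSA : measurable (A : set S) by rewrite mS.
rewrite integral_nneseries//; last by move=> n; exact: measurable_funTS.
under eq_eseriesr do rewrite YE//.
rewrite -integral_nneseries//; last by move=> n; exact: measurable_funTS.
by apply: eq_integral => w _; rewrite XE.
Qed.

Let is_condexpS (X : T -> R) (Y : S -> \bar R) : measurable_fun setT Y ->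
  (forall A, G A -> \int[P]_(w in A) Y w = \int[P]_(w in A) (X w)%:E) ->
  is_condexp P G X Y.
Proof.
move=> mY YE; split => // _ [B mB <-].
by rewrite -mS; exact: mY.
Qed.

Let measT (Y : S -> \bar R) : measurable_fun setT Y ->
  measurable_fun setT (Y : T -> \bar R).
Proof. by move=> mY; exact: (measurableT_comp mY mp). Qed.

Let transfer_ge0 (Y : S -> \bar R) A : measurable_fun setT Y ->
  (forall w, 0 <= Y w) -> G A -> \int[Q]_(w in A) Y w = \int[P]_(w in A) Y w.
Proof.
move=> mY Y0 GA; rewrite ge0_integral_pushforward//; first by rewrite mS.
exact: measurable_funTS.
Qed.

Lemma condexpP (X : T -> R) : measurable_fun setT X ->
  (forall w, (0 <= X w)%R) \/ P.-integrable setT (EFin \o X) ->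
  is_condexp P G X (condexp P G X).
Proof.
move=> mX hX; apply: xgetPex.
have meX : measurable_fun setT (EFin \o X) by exact/measurable_EFinP.
case: hX => [X0|iX].
  have [w|w|Y [mY Y0 YE]] := exists_condexp_ge0 meX; rewrite ?lee_fin ?ltry//.
  exists Y; apply: is_condexpS => // A GA.
  by rewrite -transfer_ge0// YE.
have [w|w|Y1 [mY1 Y10 Y1E]] := exists_condexp_ge0 (measurable_funepos meX).
- exact: funepos_ge0.
- by rewrite funeposE /= -EFin_max ltry.
have [w|w|Y2 [mY2 Y20 Y2E]] := exists_condexp_ge0 (measurable_funeneg meX).
- exact: funeneg_ge0.
- by rewrite funenegE /= -EFin_max ltry.
have GT : G setT by case: sG => G0 GC _; rewrite -(setD0 setT); exact: GC.
have int (X' : T -> \bar R) (Y : S -> \bar R) : measurable_fun setT Y ->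
    (forall w, 0 <= Y w) -> (forall w, 0 <= X' w) -> P.-integrable setT X' ->
    (forall A, G A -> \int[Q]_(w in A) Y w = \int[P]_(w in A) X' w) ->
    P.-integrable setT (Y : T -> \bar R).
  move=> mY Y0 X'0 iX' YE; apply/integrableP; split; first exact: measT.
  under eq_integral do rewrite gee0_abs//.
  rewrite -transfer_ge0// YE//.
  by rewrite -ge0_fin_numE ?integral_ge0//; exact: integrable_fin_num.
exists (Y1 \- Y2); apply: is_condexpS; first exact: emeasurable_funB.
move=> A GA; have mA := Gm GA.
rewrite [RHS]integralE integralB//.
- by rewrite -(transfer_ge0 mY1)// -(transfer_ge0 mY2)// Y1E// Y2E.
- apply: (integrableS measurableT) => //.
  by apply: int Y1E => //; exact: integrable_funepos.
- apply: (integrableS measurableT) => //.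
  by apply: int Y2E => //; exact: integrable_funeneg.
Qed.

End condexp_exists.

(* Main.v *)
Require Import Defs.
From HB Require Import structures.
From mathcomp Require Import all_boot all_order all_algebra.
From mathcomp Require Import all_classical all_reals all_analysis.
From mathcomp Require Import measurable_realfun ring.

(** Fix [t > 0] and split the Brownian path at time [t].  The bridge
    [W s - s / t * W t], [0 < s < t], generates a sigma-algebra [E]; the pair
    (position at [t], increments after [t]) together with [tau] generates
    another one, [G].  The proof rests on four facts.

    - [E] and [G] are independent ([bridge_present_future_independent]).  The
      Gaussian input is two-dimensional: for independent centred Gaussian [X]
      and [Y] of variances [a] and [b], the sum [X + Y] is independent of the
      residual [X - a / (a + b) * (X + Y)] ([normal_prob_shear]).  Adding one
      time after the other, and regrouping independent sigma-algebras with
      [independent_join], extends this to the whole path.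
    - For [u >= t] the variable [beta u] is measurable for [G]
      ([information_present_future]), since it involves [W] only at [u] and at
      the time [max (tau, u)], which is not before [t].
    - Before [tau] one has
      [beta s = (W s - s / t * W t) + s / t * beta t] for [s <= t], so on the
      event [tau > t] the past of [beta] is contained in the join of [E] and of
      the sigma-algebra of [beta t] ([information_trace]).
    - The event [tau > t] is, up to a null set, the event [beta t != 0]: if
      [tau <= t] then [beta t = 0], and if [tau > t] then [beta t = 0] forces
      [W t] to be equal to a variable independent of it, which has probability
      zero because [W t] has no atoms ([information_zero_before_tau]).

    Put [X = f (beta (t + h))] and let [Y] be a version of its conditional
    expectation given [beta t].  On the event [beta t != 0] it is enough to
    compare the integrals of [X] and [Y] over an intersection of some [e] in
    [E] with an event depending on [beta t] only.  Both integrands being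
    measurable for [G], both integrals have the factor [P e], and the remaining
    factors agree by the choice of [Y] ([join_integral_eq]).  On the event
    [beta t = 0] the variable [X] is almost surely the constant [f 0].  Hence
    some [Y] is a version of the conditional expectation for both
    sigma-algebras ([common_condexp]), and versions are almost surely unique
    ([ae_eq_same_integrals]).  At time [0] the two sigma-algebras coincide. *)

Set Implicit Arguments.
Unset Strict Implicit.
Unset Printing Implicit Defensive.

Import Order.TTheory GRing.Theory Num.Theory numFieldNormedType.Exports.

Local Open Scope classical_set_scope.
Local Open Scope ring_scope.

(** * Sub-sigma-algebras and independence *)

Section sub_sigma_algebras.
Context {d : measure_display} {T : measurableType d} {R : realType}.
Implicit Types (G H : set (set T)) (X : R -> T -> R) (D : set R).

Lemma sigma_algebra_setT G : sigma_algebra setT G -> G setT.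
Proof. by case=> G0 GC _; rewrite -(setD0 setT); exact: GC. Qed.

Lemma sigma_algebra_setI G A B : sigma_algebra setT G ->
  G A -> G B -> G (A `&` B).
Proof.
move=> sG GA GB.
have := @measurableI _ (g_sigma_algebraType G) A B.
by rewrite /measurable/= sigma_algebra_id//; exact.
Qed.

Lemma sigma_rvP {d' : measure_display} {T' : measurableType d'} G
    (Y : T -> T') :
  sigma_algebra setT G ->
  sigma_rv Y `<=` G <-> measurable_fun (setT : set (g_sigma_algebraType G)) Y.
Proof.
move=> sG; split=> [YG _ B mB|mY _ [B mB <-]].
  by rewrite /measurable/= sigma_algebra_id//; apply: YG; exists B.
by have := mY measurableT _ mB; rewrite /measurable/= sigma_algebra_id.
Qed.

Lemma sigma_rv_measurable {d' : measure_display} {T' : measurableType d'}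
  (Y : T -> T') : measurable_fun setT Y -> sigma_rv Y `<=` measurable.
Proof. by move=> mY _ [B mB <-]; exact: mY. Qed.

Lemma measurable_sigma_rv {d' : measure_display} {T' : measurableType d'}
  G (Y : T -> T') : G `<=` measurable -> sigma_rv Y `<=` G ->
  measurable_fun setT Y.
Proof. by move=> Gm YG _ B mB; apply/Gm/YG; exists B. Qed.

Lemma sigma_algebra_sigma_rv {d' : measure_display} {T' : measurableType d'}
  (Y : T -> T') : sigma_algebra setT (sigma_rv Y).
Proof. exact/sigma_algebra_preimage/sigma_algebra_measurable. Qed.

Lemma sub_sigma_process D X s : D s -> sigma_rv (X s) `<=` sigma_process D X.
Proof. by move=> Ds A XA; apply: sub_sigma_algebra; exists s. Qed.

Lemma sigma_process_sub D X G : sigma_algebra setT G ->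
  (forall s, D s -> sigma_rv (X s) `<=` G) -> sigma_process D X `<=` G.
Proof. by move=> sG XG; apply: smallest_sub => // A [s Ds]; exact: XG. Qed.

Lemma sigma_join_sub G H K : sigma_algebra setT K -> G `<=` K -> H `<=` K ->
  <<s G `|` H >> `<=` K.
Proof. by move=> sK GK HK; apply: smallest_sub => // A [/GK|/HK]. Qed.

Lemma sub_sigma_joinl G H : G `<=` <<s G `|` H >>.
Proof. by move=> A GA; apply: sub_sigma_algebra; left. Qed.

Lemma sub_sigma_joinr G H : H `<=` <<s G `|` H >>.
Proof. by move=> A GA; apply: sub_sigma_algebra; right. Qed.

(** A pi-system generating the join of two sigma-algebras. *)
Definition rectangles G H : set (set T) :=
  [set A | exists B C, [/\ G B, H C & A = B `&` C]].

Lemma rectanglesI G H : sigma_algebra setT G -> sigma_algebra setT H ->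
  setI_closed (rectangles G H).
Proof.
move=> sG sH _ _ [B [C [GB HC ->]]] [B' [C' [GB' HC' ->]]].
exists (B `&` B'), (C `&` C'); split; last by rewrite setIACA.
- exact: sigma_algebra_setI.
- exact: sigma_algebra_setI.
Qed.

Lemma rectanglesT G H : sigma_algebra setT G -> sigma_algebra setT H ->
  rectangles G H setT.
Proof.
move=> /sigma_algebra_setT GT /sigma_algebra_setT HT.
by exists setT, setT; rewrite setIT.
Qed.

Lemma sigma_joinE G H : sigma_algebra setT G -> sigma_algebra setT H ->
  <<s G `|` H >> = <<s rectangles G H >>.
Proof.
move=> sG sH; have sK := smallest_sigma_algebra setT (G `|` H).
apply/seteqP; split.
  apply: sub_sigma_algebra2 => A [GA|HA].
    by exists A, setT; split=> //; [exact: sigma_algebra_setT|rewrite setIT].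
  by exists setT, A; split=> //; [exact: sigma_algebra_setT|rewrite setTI].
apply: smallest_sub => // _ [B [C [GB HC ->]]].
apply: (sigma_algebra_setI sK).
  exact: sub_sigma_joinl.
exact: sub_sigma_joinr.
Qed.

End sub_sigma_algebras.

Section independence.
Context {d : measure_display} {T : measurableType d} {R : realType}.
Variable P : probability T R.
Implicit Types (G H K : set (set T)) (X : R -> T -> R) (D : set R).

Lemma independentC G H : independent P G H -> independent P H G.
Proof. by move=> GH A B HA GB; rewrite setIC muleC; exact: GH. Qed.

Lemma sub_independent G H G' H' : G' `<=` G -> H' `<=` H ->
  independent P G H -> independent P G' H'.
Proof. by move=> GG HH GH A B /GG GA /HH HB; exact: GH. Qed.

(** Only finite measures are compared below, and the generating class always
    contains the whole space, which then plays the part of an exhausting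
    sequence. *)
Lemma measure_eq_pi_system G (m1 m2 : {measure set T -> \bar R}) :
  setI_closed G -> G setT -> G `<=` measurable -> (m1 setT < +oo)%E ->
  (forall A, G A -> m1 A = m2 A) -> forall A, <<s G >> A -> m1 A = m2 A.
Proof.
move=> IG GT Gm m1T m12.
apply: (g_sigma_algebra_measure_unique G Gm (fun=> setT)) => //.
by apply: bigcup_const; exists 0%N.
Qed.

(** For [B] fixed in [H], the finite measures sending [A] to [P (A `&` B)] and
    to [P A * P B] agree on the pi-system. *)
Lemma independent_pi_system G H : setI_closed G -> G setT ->
  G `<=` measurable -> H `<=` measurable ->
  independent P G H -> independent P <<s G >> H.
Proof.
move=> IG GT Gm Hm GH A B GA HB; have mB := Hm _ HB.
pose c := NngNum (fine_ge0 (measure_ge0 P B)).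
have cE : (c%:num%:E = P B)%E by rewrite /= fineK// fin_num_measure.
have cPE C : (mscale c P C = P C * P B)%E by rewrite /mscale cE muleC.
rewrite -cPE.
apply: (@measure_eq_pi_system G (mrestr P mB) (mscale c P)) GA => //.
  by rewrite -ge0_fin_numE ?fin_num_measure.
by move=> C GC; rewrite [RHS]cPE; exact: GH.
Qed.

(** On rectangles the product rule telescopes:
    [P (a b c) = P (a b) P c = P a P b P c = P a P (b c)].  This rule takes the
    place of joint independence: every independence statement about the path is
    built by regrouping two independent sigma-algebras at a time. *)
Lemma independent_join G H K : sigma_algebra setT G -> sigma_algebra setT H ->
  sigma_algebra setT K -> G `<=` measurable -> H `<=` measurable ->
  K `<=` measurable -> independent P G H ->
  independent P <<s G `|` H >> K -> independent P G <<s H `|` K >>.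
Proof.
move=> sG sH sK Gm Hm Km GH GHK; apply: independentC; rewrite sigma_joinE//.
apply: independent_pi_system => //.
- exact: rectanglesI.
- exact: rectanglesT.
- by move=> _ [B [C [HB KC ->]]]; apply: measurableI; [exact: Hm|exact: Km].
move=> _ A [B [C [HB KC ->]]] GA.
rewrite setIC setIA GHK//; last first.
  apply: (sigma_algebra_setI (smallest_sigma_algebra _ _)).
    exact: sub_sigma_joinl.
  exact: sub_sigma_joinr.
rewrite (GHK B C)//; last exact: sub_sigma_joinr.
by rewrite GH// -muleA muleC.
Qed.

(** The events depending on finitely many times of [D] form a pi-system,
    because two finite lists of times can be concatenated. *)
Lemma independent_finite_sub D X H :
  (forall s, D s -> measurable_fun setT (X s)) ->
  H `<=` measurable ->
  (forall S : seq R, [set` S] `<=` D ->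
    independent P (sigma_process [set` S] X) H) ->
  independent P (sigma_process D X) H.
Proof.
move=> mX Hm SH.
pose G : set (set T) := [set A | exists2 S : seq R, [set` S] `<=` D &
  sigma_process [set` S] X A].
have -> : sigma_process D X = <<s G >>.
  apply/seteqP; split.
    apply: sub_sigma_algebra2 => A [s Ds XA]; exists [:: s].
      by move=> r /=; rewrite inE => /eqP ->.
    by apply: (@sub_sigma_process _ _ _ _ X s) => //=; rewrite inE.
  apply: smallest_sub; first exact: smallest_sigma_algebra.
  move=> A [S SD]; apply: sub_sigma_algebra2 => B [s /SD Ds XB].
  by exists s.
apply: independent_pi_system => //.
- move=> A B [S SD SA] [S' SD' SB]; exists (S ++ S').
    by move=> r /=; rewrite mem_cat => /orP[/SD|/SD'].
  apply: (sigma_algebra_setI (smallest_sigma_algebra _ _)).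
    apply: sub_sigma_algebra2 SA => C [s Ss XC]; exists s => //=.
    by rewrite mem_cat (_ : s \in S).
  apply: sub_sigma_algebra2 SB => C [s Ss XC]; exists s => //=.
  by rewrite mem_cat (_ : s \in S') ?orbT.
- exists [::]; first by move=> r.
  exact: sigma_algebra_setT (smallest_sigma_algebra _ _).
- move=> A [S SD]; apply: sigma_process_sub => //.
    exact: sigma_algebra_measurable.
  by move=> s /SD Ds; apply: sigma_rv_measurable; exact: mX.
- by move=> A B [S SD SA]; exact: SH SA.
Qed.

Lemma independent_sigma_process_nil (X : R -> T -> R) H : H `<=` measurable ->
  independent P (sigma_process [set` [::]] X) H.
Proof.
move=> Hm; apply: (@sub_independent <<s [set setT] >> H) => //.
  apply: sub_sigma_algebra2 => A [s].
  by rewrite /= in_nil.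
apply: independent_pi_system => //.
- by move=> A B -> ->; rewrite setIT.
- by move=> A ->; exact: measurableT.
- by move=> A B -> HB; rewrite setTI probability_setT mul1e.
Qed.

End independence.

(** * Two independent centred Gaussian variables *)

Section gaussian_pair.
Context {R : realType}.
Notation mu := (@lebesgue_measure R).
Local Open Scope ereal_scope.

Lemma ge0_integral_translation (f : measurableTypeR R -> \bar R) (a : R) :
  measurable_fun setT f -> (forall x, 0 <= f x) ->
  \int[mu]_x f (x + a)%R = \int[mu]_x f x.
Proof.
move=> mf f0.
pose phi : measurableTypeR R -> measurableTypeR R := fun x => (x + a)%R.
have mphi : measurable_fun setT phi by exact: measurable_funD.
have muE A : measurable A -> mu A = pushforward mu phi A.
  apply: (@lebesgue_measure_unique R (pushforward mu phi)) => //.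
  move=> _ [[x y] _ <-] /=.
  have -> : pushforward mu phi `]x, y] = mu `](x - a)%R, (y - a)%R].
    congr (mu _); apply/seteqP; split => z /=.
      by rewrite !in_itv/= ltrBlDr lerBrDr.
    by rewrite !in_itv/= ltrBlDr lerBrDr.
  rewrite !lebesgue_measure_itv/= !lte_fin ltrD2r.
  by case: ifPn => // _; rewrite -!EFinB; congr EFin; ring.
rewrite [RHS](eq_measure_integral (pushforward mu phi))//; last first.
  by move=> A mA _; exact: muE.
by rewrite (ge0_integral_pushforward mphi).
Qed.

(** The density and the Radon-Nikodym derivative of the normal law have the same
    integrals, hence are almost everywhere equal. *)
Lemma ge0_integral_normal_prob (m s : R) (h : measurableTypeR R -> \bar R) :
  measurable_fun setT h -> (forall x, 0 <= h x) ->
  \int[normal_prob m s]_x h x = \int[mu]_x (h x * (normal_pdf m s x)%:E).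
Proof.
move=> mh h0.
pose N : {finite_measure set _ -> \bar R} := normal_prob m s.
have Nmu : N `<< mu by exact: normal_prob_dominates.
rewrite -(Radon_Nikodym_SigmaFinite.change_of_variables Nmu)//.
apply: ae_eq_integral => //.
- apply: emeasurable_funM => //; apply: measurable_int.
  exact: Radon_Nikodym_SigmaFinite.f_integrable.
- apply: emeasurable_funM => //; apply/measurable_EFinP.
  exact: measurable_normal_pdf.
apply: ae_eqe_mul2l; apply: integral_ae_eq => //.
- exact: Radon_Nikodym_SigmaFinite.f_integrable.
- by apply/measurable_EFinP; exact: measurable_normal_pdf.
by move=> A _ mA; rewrite -Radon_Nikodym_SigmaFinite.f_integral.
Qed.

(** Completing the square: with [c = a / (a + b)] and [v = a * b / (a + b)],
    [(x + c y)^2 / a + (y - (x + c y))^2 / b = x^2 / v + y^2 / (a + b)].  The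
    normalizing constants match because [v * (a + b) = a * b]. *)
Lemma normal_pdf_shear (a b x y : R) : (0 < a -> 0 < b ->
  normal_pdf 0 (Num.sqrt a) (x + a / (a + b) * y) *
    normal_pdf 0 (Num.sqrt b) (y - (x + a / (a + b) * y)) =
  normal_pdf 0 (Num.sqrt (a * b / (a + b))) x *
    normal_pdf 0 (Num.sqrt (a + b)) y)%R.
Proof.
move=> a0 b0.
have ab0 : (0 < a + b)%R by rewrite addr_gt0.
have v0 : (0 < a * b / (a + b))%R by rewrite divr_gt0// mulr_gt0.
have s0 (c : R) : (0 < c)%R -> Num.sqrt c != 0%R by rewrite sqrtr_eq0 -ltNge.
rewrite !normal_pdfE ?s0// /normal_peak /normal_fun !sqr_sqrtr ?ltW//.
rewrite mulrACA [RHS]mulrACA -!expRD -!invfM -!sqrtrM; first last.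
- by rewrite mulrn_wge0// mulr_ge0 ?pi_ge0// ltW.
- by rewrite mulrn_wge0// mulr_ge0 ?pi_ge0// ltW.
congr (_ * expR _)%R.
  congr ((Num.sqrt _)^-1)%R; field.
  by rewrite gt_eqF.
by field; rewrite !gt_eqF.
Qed.

Lemma measurable_shear_rectangle (c : R) (B C : set (measurableTypeR R)) :
  measurable B -> measurable C -> measurable
  [set p : (measurableTypeR R * measurableTypeR R)%type |
    B (p.1 - c * (p.1 + p.2))%R /\ C (p.1 + p.2)%R].
Proof.
move=> mB mC; set D := [set p | _].
pose g1 (p : measurableTypeR R * measurableTypeR R) :=
  (p.1 - c * (p.1 + p.2))%R.
pose g2 (p : measurableTypeR R * measurableTypeR R) := (p.1 + p.2)%R.
have mg2 : measurable_fun setT g2 by exact: measurable_funD.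
have mg1 : measurable_fun setT g1.
  by apply: measurable_funB => //; exact: measurable_funM.
have -> : D = (setT `&` g1 @^-1` B) `&` (setT `&` g2 @^-1` C).
  by rewrite !setTI.
by apply: measurableI; [exact: mg1|exact: mg2].
Qed.

(** The map sending [(x, y)] to [(x - c * (x + y), x + y)] is the composite of
    two shears.  By Tonelli each of them is, for one coordinate fixed, a
    translation of the other, which preserves Lebesgue measure; after both the
    density factorizes by [normal_pdf_shear]. *)
Lemma normal_prob_shear (a b : R) (B C : set (measurableTypeR R)) :
  (0 < a)%R -> (0 < b)%R -> measurable B -> measurable C ->
  (normal_prob 0 (Num.sqrt a) \x normal_prob 0 (Num.sqrt b))
    [set p | B (p.1 - a / (a + b) * (p.1 + p.2))%R /\ C (p.1 + p.2)%R] =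
  normal_prob 0 (Num.sqrt (a * b / (a + b))) B *
  normal_prob 0 (Num.sqrt (a + b)) C.
Proof.
move=> a0 b0 mB mC; set c := (a / (a + b))%R; set v := (a * b / _)%R.
set D := [set p | _].
pose pa := normal_pdf 0 (Num.sqrt a); pose pb := normal_pdf 0 (Num.sqrt b).
pose pv := normal_pdf 0 (Num.sqrt v).
pose ps := normal_pdf 0 (Num.sqrt (a + b)).
have mD : measurable D by exact: measurable_shear_rectangle.
have mpa : measurable_fun setT pa by exact: measurable_normal_pdf.
have mpb : measurable_fun setT pb by exact: measurable_normal_pdf.
pose F (p : measurableTypeR R * measurableTypeR R) : \bar R :=
  (\1_D p * (pa p.1 * pb p.2))%:E.
have F0 p : 0 <= F p.
  by rewrite lee_fin !mulr_ge0// /pa /pb normal_pdf_ge0.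
have mF : measurable_fun setT F.
  apply/measurable_EFinP; apply: measurable_funM => //.
  by apply: measurable_funM; exact: measurableT_comp.
transitivity (\int[mu]_x \int[mu]_y F (x, y)).
  rewrite /product_measure1 ge0_integral_normal_prob//; last first.
    by apply: measurable_fun_xsection.
  apply: eq_integral => x _ /=.
  have -> : normal_prob 0 (Num.sqrt b) (xsection D x) =
      \int[mu]_y (\1_D (x, y) * pb y)%:E.
    rewrite /normal_prob integral_mkcond; apply: eq_integral => y _.
    by rewrite patchE mem_xsection indicE; case: ifP => _; rewrite ?mul1r ?mul0r.
  rewrite -ge0_integralZr//=.
  - by apply: eq_integral => y _; rewrite /F/= -EFinM mulrAC mulrA.
  - apply/measurable_EFinP; apply: measurable_funM => //.
    by apply: (@measurableT_comp _ _ _ _ _ _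
      (\1_D : measurableTypeR R * measurableTypeR R -> R)).
  - by move=> y _; rewrite lee_fin mulr_ge0// /pb normal_pdf_ge0.
  - by rewrite lee_fin /pa normal_pdf_ge0.
(* First shear: the second variable becomes the sum. *)
pose F1 (p : measurableTypeR R * measurableTypeR R) := F (p.1, p.2 - p.1)%R.
have F10 p : 0 <= F1 p by exact: F0.
have mF1 : measurable_fun setT F1.
  apply: measurableT_comp => //; apply: measurable_fun_pair => //.
  exact: measurable_funB.
transitivity (\int[mu]_x \int[mu]_y F1 (x, y)).
  apply: eq_integral => x _; rewrite /F1/=.
  rewrite (@ge0_integral_translation (fun y => F (x, y)))//.
  by apply: measurableT_comp.
rewrite fubini_tonelli//.
(* Second shear: the first variable becomes the residual. *)
transitivity (\int[mu]_y \int[mu]_x F1 (x + c * y, y)%R).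
  apply: eq_integral => y _.
  rewrite (@ge0_integral_translation (fun x => F1 (x, y)))//.
  exact: measurable_fun_pair1.
transitivity (\int[mu]_y \int[mu]_x
  ((\1_B x * pv x)%:E * (\1_C y * ps y)%:E)).
  apply: eq_integral => y _; apply: eq_integral => x _.
  rewrite /F1 /F/= -EFinM mulrACA; congr (_ * _)%:E.
    rewrite !indicE.
    have e1 : (x + c * y + (y - (x + c * y)) = y)%R by rewrite addrC subrK.
    have -> : ((x + c * y, y - (x + c * y)) \in D)%R = (x \in B) && (y \in C).
      apply/idP/andP => [/set_mem[]|[/set_mem Bx /set_mem Cy]].
        by rewrite /= e1 addrK => Bx Cy; split; exact/mem_set.
      by apply/mem_set; rewrite /D/= e1 addrK.
    by rewrite -mulnb natrM.
  exact: normal_pdf_shear.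
transitivity (\int[mu]_y ((normal_prob 0 (Num.sqrt v) B) * (\1_C y * ps y)%:E)).
  apply: eq_integral => y _; rewrite ge0_integralZr//; last 3 first.
  - apply/measurable_EFinP; apply: measurable_funM => //.
    exact: measurable_normal_pdf.
  - by move=> x _; rewrite lee_fin mulr_ge0// /pv normal_pdf_ge0.
  - by rewrite lee_fin mulr_ge0// /ps normal_pdf_ge0.
  congr (_ * _); rewrite /normal_prob [RHS]integral_mkcond.
  apply: eq_integral => x _.
  by rewrite patchE indicE; case: ifP => _; rewrite ?mul1r ?mul0r.
rewrite ge0_integralZl//; last 2 first.
- apply/measurable_EFinP; apply: measurable_funM => //.
  exact: measurable_normal_pdf.
- by move=> x _; rewrite lee_fin mulr_ge0// /ps normal_pdf_ge0.
congr (_ * _); rewrite /normal_prob [RHS]integral_mkcond.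
apply: eq_integral => x _.
by rewrite patchE indicE; case: ifP => _; rewrite ?mul1r ?mul0r.
Qed.

End gaussian_pair.
(** * Joint laws of independent variables *)

Section joint_law.
Context {d : measure_display} {T : measurableType d} {R : realType}.
Variable P : probability T R.
Local Open Scope ereal_scope.

Lemma independent_joint_law {d1 d2 : measure_display} {T1 : measurableType d1}
    {T2 : measurableType d2} (X : T -> T1) (Y : T -> T2)
    (m1 : {sigma_finite_measure set T1 -> \bar R})
    (m2 : {sigma_finite_measure set T2 -> \bar R}) (D : set (T1 * T2)%type) :
  measurable_fun setT X -> measurable_fun setT Y ->
  (forall A, measurable A -> P (X @^-1` A) = m1 A) ->
  (forall A, measurable A -> P (Y @^-1` A) = m2 A) ->
  independent P (sigma_rv X) (sigma_rv Y) -> measurable D ->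
  P [set w | D (X w, Y w)] = (m1 \x m2) D.
Proof.
move=> mX mY Xm1 Ym2 XY mD.
pose XYmixin := isMeasurableFun.Build _ _ _ _ _ (measurable_fun_pair mX mY).
pose Z : {mfun T >-> (T1 * T2)%type} := HB.pack (fun w => (X w, Y w)) XYmixin.
have := @product_measure_unique _ _ _ _ _ m1 m2 (distribution P Z).
move=> /(_ _ _ mD) -> // A B mA mB.
rewrite -Xm1// -Ym2// -XY//.
- by exists A; rewrite ?setTI.
- by exists B; rewrite ?setTI.
Qed.

(** The joint law of [c] and [X] is a product, and the diagonal has sections of
    measure zero for the law of [X]. *)
Lemma independent_atomless_neq (G : set (set T)) (X c : T -> R) :
  sigma_algebra setT G -> G `<=` measurable -> measurable_fun setT X ->
  (forall x, P (X @^-1` [set x]) = 0) -> independent P (sigma_rv X) G ->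
  sigma_rv c `<=` G -> P [set w | X w = c w] = 0.
Proof.
move=> sG Gm mX X0 XG cG.
have mc : measurable_fun setT c by exact: measurable_sigma_rv cG.
pose X' : {mfun T >-> R} := HB.pack X (isMeasurableFun.Build _ _ _ _ _ mX).
pose c' : {mfun T >-> R} := HB.pack c (isMeasurableFun.Build _ _ _ _ _ mc).
pose diag : set (R * R)%type := [set p | p.1 = p.2].
have mdiag : measurable diag.
  have -> : diag = setT `&` (fun p : (R * R)%type => p.1 - p.2)%R @^-1` [set 0%R].
    rewrite setTI; apply/seteqP; split => p /=; rewrite /diag/=.
      by move=> ->; rewrite subrr.
    by move/eqP; rewrite subr_eq0 => /eqP.
  have : measurable_fun setT (fun p : (R * R)%type => p.1 - p.2)%R.
    exact: measurable_funB.
  by apply.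
have cX : independent P (sigma_rv c) (sigma_rv X).
  by apply: independentC; apply: sub_independent XG.
have -> : [set w | X w = c w] = [set w | diag (c w, X w)].
  by apply/seteqP; split => w /=; rewrite /diag/= => ->.
rewrite (independent_joint_law (m1 := distribution P c')
  (m2 := distribution P X'))// /product_measure1.
apply: integral0_eq => x _; rewrite /= -[RHS](X0 x); congr (P _).
apply/seteqP; split => w /=; rewrite /xsection/= inE /diag/=.
  by move=> ->.
by move=> ->.
Qed.

(** [a / (a + b) * (X + Y)] is the linear regression of [X] on [X + Y]; for
    Gaussian variables the residual is not only uncorrelated with [X + Y] but
    independent of it. *)
Lemma independent_gaussian_shear (X Y : T -> R) (a b : R) :
  (0 < a)%R -> (0 < b)%R ->
  measurable_fun setT X -> measurable_fun setT Y ->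
  (forall A, measurable A -> P (X @^-1` A) = normal_prob 0 (Num.sqrt a) A) ->
  (forall A, measurable A -> P (Y @^-1` A) = normal_prob 0 (Num.sqrt b) A) ->
  independent P (sigma_rv X) (sigma_rv Y) ->
  independent P (sigma_rv (fun w => X w - a / (a + b) * (X w + Y w))%R)
    (sigma_rv (fun w => X w + Y w)%R).
Proof.
move=> a0 b0 mX mY XN YN XY.
pose Z1 w := (X w - a / (a + b) * (X w + Y w))%R.
pose Z2 w := (X w + Y w)%R.
pose N1 := normal_prob 0 (Num.sqrt (a * b / (a + b))).
pose N2 := normal_prob 0 (Num.sqrt (a + b)).
have joint B C : measurable B -> measurable C ->
    P (Z1 @^-1` B `&` Z2 @^-1` C) = N1 B * N2 C.
  move=> mB mC; rewrite -(normal_prob_shear a0 b0 mB mC).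
  rewrite -(@independent_joint_law _ _ (measurableTypeR R) (measurableTypeR R)
    X Y (normal_prob 0 (Num.sqrt a)) (normal_prob 0 (Num.sqrt b)) _ mX mY)//.
  exact: measurable_shear_rectangle.
have Z1E B : measurable B -> P (Z1 @^-1` B) = N1 B.
  move=> mB; rewrite -[LHS](_ : P (Z1 @^-1` B `&` Z2 @^-1` setT) = _).
    by rewrite joint// /N2 probability_setT mule1.
  by rewrite preimage_setT setIT.
have Z2E C : measurable C -> P (Z2 @^-1` C) = N2 C.
  move=> mC; rewrite -[LHS](_ : P (Z1 @^-1` setT `&` Z2 @^-1` C) = _).
    by rewrite joint// /N1 probability_setT mul1e.
  by rewrite preimage_setT setTI.
move=> _ _ [B mB <-] [C mC <-]; rewrite !setTI.
by rewrite (joint B C)// (Z1E B)// (Z2E C).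
Qed.

End joint_law.

(** * Independence in a Brownian path *)

Lemma strictly_decreasing_enum (R : realType) (S : seq R) :
  exists2 S' : seq R, sorted >%R S' & S' =i S.
Proof.
exists (rev (sort <=%R (undup S))).
  rewrite rev_sorted (_ : sorted _ _ = sorted <%R (sort <=%R (undup S)))//.
  by rewrite sort_lt_sorted undup_uniq.
by move=> x; rewrite mem_rev mem_sort mem_undup.
Qed.

Section sub_sigma_algebra_functions.
Context {d : measure_display} {T : measurableType d} {R : realType}.
Implicit Types (G H : set (set T)).

(** Stated with [Z] apart from its expression, so that the bridges, increments
    and information variables can be matched up to a field identity. *)
Lemma sigma_rv_linear G (X Y Z : T -> R) (a b : R) : sigma_algebra setT G ->
  sigma_rv X `<=` G -> sigma_rv Y `<=` G ->
  (forall w, Z w = a * X w + b * Y w) -> sigma_rv Z `<=` G.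
Proof.
move=> sG /(sigma_rvP _ sG) mX /(sigma_rvP _ sG) mY ZE.
have -> : Z = (fun w => a * X w + b * Y w) by exact/funext.
by apply/sigma_rvP => //; apply: measurable_funD; exact: measurable_funM.
Qed.

Lemma sigma_rv_cst G (c : R) : sigma_algebra setT G ->
  sigma_rv (cst c : T -> R) `<=` G.
Proof. by move=> sG; apply/sigma_rvP => //; exact: measurable_cst. Qed.

End sub_sigma_algebra_functions.

Section brownian_independence.
Context {d : measure_display} {T : measurableType d} {R : realType}.
Variables (P : probability T R) (W : R -> T -> R).
Hypothesis W_BM : brownian_motion P W.
Local Notation F := (natural_filtration W).

Definition brownian_bridge (u r : R) (w : T) : R := W r w - r / u * W u w.

Definition future_increment (t r : R) (w : T) : R := W r w - W t w.

(** The times [0] and [t], where the bridge vanishes, are left out. *)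
Definition bridge_algebra (t : R) : set (set T) :=
  sigma_process `]0, t[ (brownian_bridge t).

Definition future_algebra (t : R) : set (set T) :=
  sigma_process `]t, +oo[ (future_increment t).

Lemma natural_filtration_measurable t : F t `<=` measurable.
Proof.
apply: sigma_process_sub; first exact: sigma_algebra_measurable.
move=> s /=; rewrite in_itv/= => /andP[s0 _].
exact/sigma_rv_measurable/(bm_measurable W_BM).
Qed.

Lemma sub_natural_filtration t s : 0 <= s <= t -> sigma_rv (W s) `<=` F t.
Proof. by move=> st; apply: sub_sigma_process; rewrite /= in_itv. Qed.

Lemma sigma_algebra_natural_filtration t : sigma_algebra setT (F t).
Proof. exact: smallest_sigma_algebra. Qed.

Lemma bm_gaussian t A : 0 < t -> measurable A ->
  P (W t @^-1` A) = normal_prob 0 (Num.sqrt t) A.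
Proof.
move=> t0 mA; have := bm_normal W_BM (lexx 0) t0 mA.
rewrite subr0 => <-; congr (P _); apply/seteqP; split => w /=.
  by rewrite (bm_start W_BM) subr0.
by rewrite (bm_start W_BM) subr0.
Qed.

Lemma bm_increment_gaussian s t A : 0 <= s -> s < t -> measurable A ->
  P (future_increment s t @^-1` A) = normal_prob 0 (Num.sqrt (t - s)) A.
Proof. by move=> s0 st mA; rewrite -(bm_normal W_BM s0 st mA). Qed.

Lemma sub_bridge t r u : 0 <= r <= t -> 0 <= u <= t ->
  sigma_rv (brownian_bridge u r) `<=` F t.
Proof.
move=> rt ut.
apply: (sigma_rv_linear (X := W r) (Y := W u) (a := 1) (b := - (r / u))).
- exact: sigma_algebra_natural_filtration.
- exact: sub_natural_filtration.
- exact: sub_natural_filtration.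
- by move=> w; rewrite mul1r mulNr.
Qed.

Lemma sub_increment t r u : 0 <= r <= t -> 0 <= u <= t ->
  sigma_rv (future_increment u r) `<=` F t.
Proof.
move=> rt ut.
apply: (sigma_rv_linear (X := W r) (Y := W u) (a := 1) (b := -1)).
- exact: sigma_algebra_natural_filtration.
- exact: sub_natural_filtration.
- exact: sub_natural_filtration.
- by move=> w; rewrite mul1r mulN1r.
Qed.

Lemma natural_filtration_le s t : s <= t -> F s `<=` F t.
Proof.
move=> st; apply: sigma_process_sub => //.
  exact: sigma_algebra_natural_filtration.
move=> r /=; rewrite in_itv/= => /andP[r0 rs].
by apply: sub_natural_filtration; rewrite r0 (le_trans rs).
Qed.

(** Induction on the decreasing list of times, its head being the time nearest to
    [u].  For [r < s < u] the bridge pinned at [u] is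
    [brownian_bridge u r = brownian_bridge s r + r / s * brownian_bridge u s].
    The bridge pinned at [s] is independent of [W s] by induction, hence of
    [W s] and the next increment together; and
    [independent_gaussian_shear] turns this last pair into the independent pair
    of [brownian_bridge u s] and [W u]. *)
Lemma bridge_finite_independent S u : 0 < u -> path >%R u S -> all (> 0) S ->
  independent P (sigma_process [set` S] (brownian_bridge u)) (sigma_rv (W u)).
Proof.
have mW s : 0 <= s -> sigma_rv (W s) `<=` measurable.
  by move=> s0; exact/sigma_rv_measurable/(bm_measurable W_BM).
elim: S u => [|s S IH] u u0 /=.
  by move=> _ _; apply: independent_sigma_process_nil; apply: mW; exact: ltW.
move=> /andP[su sS] /andP[s0 S0].
pose E := sigma_process [set` S] (brownian_bridge s).
have sE : sigma_algebra setT E by exact: smallest_sigma_algebra.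
have Ss r : r \in S -> 0 < r < s.
  move=> rS; rewrite (allP S0)//=.
  by have /allP := order_path_min (rev_trans lt_trans) sS; exact.
have sF := sigma_algebra_natural_filtration s.
have EF : E `<=` F s.
  apply: sigma_process_sub => // r /= /Ss /andP[r0 rs].
  by apply: sub_bridge; rewrite ?lexx !ltW.
have WF : sigma_rv (W s) `<=` F s.
  by apply: sub_natural_filtration; rewrite lexx ltW.
have Fm := @natural_filtration_measurable s.
have Fum := @natural_filtration_measurable u.
pose I := sigma_rv (future_increment s u).
have Im : I `<=` measurable.
  apply: subset_trans Fum; apply: sub_increment; rewrite ?lexx ltW//.
  by rewrite ltW.
have indF : independent P (F s) I by exact: (bm_independent W_BM (ltW s0) su).
have E_WI : independent P E <<s sigma_rv (W s) `|` I >>.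
  apply: independent_join => //.
  - exact: sigma_algebra_sigma_rv.
  - exact: sigma_algebra_sigma_rv.
  - exact: subset_trans Fm.
  - exact: subset_trans Fm.
  - exact: IH.
  - apply: sub_independent indF => //; exact: sigma_join_sub.
pose eta := brownian_bridge u s.
have sWI : sigma_algebra setT <<s sigma_rv (W s) `|` I >>.
  exact: smallest_sigma_algebra.
have WuWI : sigma_rv (W u) `<=` <<s sigma_rv (W s) `|` I >>.
  apply: (sigma_rv_linear (X := W s) (Y := future_increment s u) (a := 1)
    (b := 1)) => //.
  - exact: sub_sigma_joinl.
  - exact: sub_sigma_joinr.
  - by move=> w; rewrite /future_increment !mul1r addrC subrK.
have etaWI : sigma_rv eta `<=` <<s sigma_rv (W s) `|` I >>.
  apply: (sigma_rv_linear (X := W s) (Y := W u) (a := 1) (b := - (s / u))) => //.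
  - exact: sub_sigma_joinl.
  - by move=> w; rewrite /eta /brownian_bridge mul1r mulNr.
have Wu_eta : independent P (sigma_rv (W u)) (sigma_rv eta).
  apply: independentC.
  have us : 0 < u - s by rewrite subr_gt0.
  have := @independent_gaussian_shear _ _ _ P (W s) (future_increment s u) s
    (u - s) s0 us.
  rewrite (_ : s + (u - s) = u); last by rewrite addrC subrK.
  rewrite (_ : (fun w => W s w + future_increment s u w) = W u); last first.
    by apply/funext => w; rewrite /future_increment addrC subrK.
  rewrite (_ : (fun w => W s w - s / u * (W s w + future_increment s u w)) = eta);
    last first.
    apply/funext => w; rewrite /eta /brownian_bridge /future_increment.
    by rewrite (addrC (W s w) (_ - _)) subrK.
  apply.
  - exact: (bm_measurable W_BM (ltW s0)).
  - exact: measurable_sigma_rv Im _.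
  - by move=> A mA; exact: bm_gaussian.
  - by move=> A mA; apply: bm_increment_gaussian => //; exact: ltW.
  - exact: sub_independent indF.
have := @independent_join _ _ _ P (sigma_rv (W u)) (sigma_rv eta) E.
have WIm : <<s sigma_rv (W s) `|` I >> `<=` measurable.
  apply: sigma_join_sub => //; first exact: sigma_algebra_measurable.
  exact: subset_trans Fm.
move=> /(_ (sigma_algebra_sigma_rv _) (sigma_algebra_sigma_rv _) sE).
have etam := subset_trans etaWI WIm.
move=> /(_ (mW _ (ltW u0)) etam (subset_trans EF Fm) Wu_eta).
have /[swap]/[apply] : independent P <<s sigma_rv (W u) `|` sigma_rv eta >> E.
  apply: independentC; apply: sub_independent E_WI => //.
  exact: sigma_join_sub.
move=> /independentC; apply: sub_independent => //.
have sK := @smallest_sigma_algebra _ setT (sigma_rv eta `|` E).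
apply: sigma_process_sub => // r /=; rewrite inE => /predU1P[->|rS].
  exact: sub_sigma_joinl.
apply: (sigma_rv_linear (X := brownian_bridge s r) (Y := eta) (a := 1)
  (b := r / s)) => //.
- by apply: subset_trans (@sub_sigma_joinr _ _ _ _); exact: sub_sigma_process.
- exact: sub_sigma_joinl.
move=> w; rewrite /eta /brownian_bridge; field.
by rewrite !gt_eqF.
Qed.

End brownian_independence.

Section brownian_independence_full.
Context {d : measure_display} {T : measurableType d} {R : realType}.
Variables (P : probability T R) (W : R -> T -> R).
Hypothesis W_BM : brownian_motion P W.
Local Notation F := (natural_filtration W).

Lemma bridge_algebra_sub t : bridge_algebra W t `<=` F t.
Proof.
apply: sigma_process_sub; first exact: sigma_algebra_natural_filtration.
move=> r /=; rewrite in_itv/= => /andP[r0 rt].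
apply: sub_bridge; first by rewrite !ltW.
by rewrite lexx ltW// (lt_trans r0).
Qed.

Lemma bridge_independent t : 0 < t ->
  independent P (bridge_algebra W t) (sigma_rv (W t)).
Proof.
move=> t0; have Fm := @natural_filtration_measurable _ _ _ _ _ W_BM t.
apply: independent_finite_sub.
- move=> r /=; rewrite in_itv/= => /andP[r0 rt].
  apply: (measurable_sigma_rv Fm); apply: sub_bridge.
    by rewrite !ltW.
  by rewrite lexx ltW.
- by apply: sigma_rv_measurable; apply: (bm_measurable W_BM); exact: ltW.
move=> S St; have [S' S'sorted S'S] := strictly_decreasing_enum S.
have -> : [set` S] = [set` S'] by apply/seteqP; split => r /=; rewrite S'S.
have {}St r : r \in S' -> 0 < r < t.
  by rewrite S'S => /St; rewrite /= in_itv.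
apply: bridge_finite_independent => //.
  by rewrite path_min_sorted//; apply/allP => r /St /andP[].
by apply/allP => r /St /andP[].
Qed.

(** Induction on the decreasing list of times: the last increment starts at the
    preceding time [v] and is independent of everything before [v], in particular
    of the past of [t] joined with the earlier increments. *)
Lemma future_finite_independent S t : 0 <= t -> sorted >%R S -> all (> t) S ->
  independent P (F t) (sigma_process [set` S] (future_increment W t)).
Proof.
move=> t0; have Fm := @natural_filtration_measurable _ _ _ _ _ W_BM.
elim: S => [|u S IH] uS.
  by move=> _; apply: independentC; apply: independent_sigma_process_nil; exact: Fm.
move=> /= /andP[tu St].
pose I := sigma_process [set` S] (future_increment W t).
have sI : sigma_algebra setT I by exact: smallest_sigma_algebra.
(* The preceding time is [t] itself when [u] is the only time. *)
pose v := head t S.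
have tv : t <= v by rewrite /v; case: (S) St => //= ? ? /andP[/ltW].
have v0 : 0 <= v by exact: le_trans tv.
have vu : v < u by rewrite /v; case: (S) uS => //= ? ? /andP[].
have Sv r : r \in S -> t < r <= v.
  move=> rS; rewrite (allP St)//= /v; move: rS (path_sorted uS).
  case: (S) => //= a s; rewrite inE => /predU1P[->//|rs].
  by move=> /(order_path_min (rev_trans lt_trans)) /allP /(_ _ rs) /ltW.
have IF : I `<=` F v.
  apply: sigma_process_sub; first exact: sigma_algebra_natural_filtration.
  move=> r /= /Sv /andP[tr rv]; apply: sub_increment; last by rewrite t0.
  by rewrite rv (le_trans t0)// ltW.
pose J := sigma_rv (future_increment W v u).
have Jm : J `<=` measurable.
  apply: subset_trans (Fm u); apply: sub_increment.
    by rewrite lexx (le_trans v0)// ltW.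
  by rewrite v0 ltW.
have indJ : independent P (F v) J by exact: (bm_independent W_BM v0 vu).
have F_IJ : independent P (F t) <<s I `|` J >>.
  apply: independent_join => //.
  - exact: sigma_algebra_natural_filtration.
  - exact: sigma_algebra_sigma_rv.
  - exact: subset_trans (Fm v).
  - by apply: IH => //; exact: path_sorted uS.
  - apply: sub_independent indJ => //; apply: sigma_join_sub => //.
      exact: sigma_algebra_natural_filtration.
    exact: natural_filtration_le.
apply: sub_independent F_IJ => //.
have sK := @smallest_sigma_algebra _ setT (I `|` J).
have IvK : sigma_rv (future_increment W t v) `<=` <<s I `|` J >>.
  have [vt|vt] := eqVneq v t.
    rewrite vt (_ : future_increment W t t = cst 0); last first.
      by apply/funext => w; rewrite /future_increment subrr.
    exact: sigma_rv_cst.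
  apply: subset_trans (@sub_sigma_joinl _ _ _ _).
  apply: sub_sigma_process; move: vt; rewrite /v /=.
  by case: (S) => [|? ?] /=; rewrite ?eqxx// inE eqxx.
apply: sigma_process_sub => // r /=; rewrite inE => /predU1P[->|rS].
  apply: (sigma_rv_linear (X := future_increment W t v)
    (Y := future_increment W v u) (a := 1) (b := 1)) => //.
    exact: sub_sigma_joinr.
  by move=> w; rewrite /future_increment; ring.
by apply: subset_trans (@sub_sigma_joinl _ _ _ _); exact: sub_sigma_process.
Qed.

Lemma future_independent t : 0 <= t ->
  independent P (F t) (future_algebra W t).
Proof.
move=> t0; have Fm := @natural_filtration_measurable _ _ _ _ _ W_BM.
apply: independentC; apply: independent_finite_sub => //.
  move=> r /=; rewrite in_itv/= andbT => tr.
  apply: (measurable_sigma_rv (Fm r)); apply: sub_increment.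
    by rewrite lexx (le_trans t0)// ltW.
  by rewrite t0 ltW.
move=> S St; apply: independentC.
have [S' S'sorted S'S] := strictly_decreasing_enum S.
have -> : [set` S] = [set` S'] by apply/seteqP; split => r /=; rewrite S'S.
apply: future_finite_independent => //.
by apply/allP => r; rewrite S'S => /St; rewrite /= in_itv/= andbT.
Qed.

Variable tau : T -> R.
Hypothesis mtau : measurable_fun setT tau.
Hypothesis indep_tau_W : independent P (sigma_rv tau) (sigma_process `[0, +oo[ W).

Definition future_time_algebra t := <<s future_algebra W t `|` sigma_rv tau >>.

Definition present_future_algebra t :=
  <<s sigma_rv (W t) `|` future_time_algebra t >>.

Lemma future_algebra_measurable t : 0 <= t ->
  future_algebra W t `<=` sigma_process `[0, +oo[ W.
Proof.
move=> t0.
have sW : sigma_algebra setT (sigma_process `[0, +oo[ W).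
  exact: smallest_sigma_algebra.
apply: sigma_process_sub => // r; rewrite /= in_itv/= andbT => tr.
apply: (sigma_rv_linear (X := W r) (Y := W t) (a := 1) (b := -1)) => //.
- by apply: sub_sigma_process; rewrite /= in_itv/= andbT (le_trans t0)// ltW.
- by apply: sub_sigma_process; rewrite /= in_itv/= andbT.
- by move=> w; rewrite mul1r mulN1r.
Qed.

Lemma all_times_measurable : sigma_process `[0, +oo[ W `<=` measurable.
Proof.
apply: sigma_process_sub; first exact: sigma_algebra_measurable.
move=> s; rewrite /= in_itv/= andbT => s0.
exact/sigma_rv_measurable/(bm_measurable W_BM).
Qed.

Lemma future_time_algebra_measurable t : 0 <= t ->
  future_time_algebra t `<=` measurable.
Proof.
move=> t0; apply: sigma_join_sub; first exact: sigma_algebra_measurable.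
  by apply: subset_trans all_times_measurable; exact: future_algebra_measurable.
exact: sigma_rv_measurable.
Qed.

Lemma present_future_algebra_measurable t : 0 <= t ->
  present_future_algebra t `<=` measurable.
Proof.
move=> t0; apply: sigma_join_sub; first exact: sigma_algebra_measurable.
  exact/sigma_rv_measurable/(bm_measurable W_BM).
exact: future_time_algebra_measurable.
Qed.

Lemma past_future_time_independent t : 0 <= t ->
  independent P (F t) (future_time_algebra t).
Proof.
move=> t0; have Wm := all_times_measurable.
have FW : F t `<=` sigma_process `[0, +oo[ W.
  apply: sub_sigma_algebra2; apply: bigcup_subset => s /=.
  by rewrite !in_itv/= andbT => /andP[].
have future_W := future_algebra_measurable t0.
apply: independent_join.
- exact: sigma_algebra_natural_filtration.
- exact: smallest_sigma_algebra.
- exact: sigma_algebra_sigma_rv.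
- exact: subset_trans Wm.
- exact: subset_trans Wm.
- exact: sigma_rv_measurable.
- exact: future_independent.
- apply: independentC; apply: sub_independent indep_tau_W => //.
  by apply: sigma_join_sub => //; exact: smallest_sigma_algebra.
Qed.

(** The bridge before [t] and the position at [t] are independent of one another,
    and both are determined by the path up to [t], hence independent of what
    comes after. *)
Lemma bridge_present_future_independent t : 0 < t ->
  independent P (bridge_algebra W t) (present_future_algebra t).
Proof.
move=> t0; have Fm := @natural_filtration_measurable _ _ _ _ _ W_BM t.
have WF : sigma_rv (W t) `<=` F t.
  by apply: sub_natural_filtration; rewrite lexx ltW.
have EF := @bridge_algebra_sub t.
apply: independent_join.
- exact: smallest_sigma_algebra.
- exact: sigma_algebra_sigma_rv.
- exact: smallest_sigma_algebra.
- exact: subset_trans Fm.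
- exact: subset_trans Fm.
- by apply: future_time_algebra_measurable; exact: ltW.
- exact: bridge_independent.
- apply: sub_independent (past_future_time_independent (ltW t0)) => //.
  by apply: sigma_join_sub => //; exact: sigma_algebra_natural_filtration.
Qed.

End brownian_independence_full.

(** * Evaluating a process at a random time *)

Section random_time.
Context {d : measure_display} {T : measurableType d} {R : realType}.

(** The random time is approached strictly from above along the grid of mesh
    [1 / (n + 1)], so that the approximations use the process only at times
    larger than [t]. *)
Lemma sigma_rv_random_time (G : set (set T)) (Z : R -> T -> R) (rho : T -> R)
    (t : R) : sigma_algebra setT G -> 0 <= t -> (forall w, t <= rho w) ->
  sigma_rv rho `<=` G -> (forall r, t < r -> sigma_rv (Z r) `<=` G) ->
  (forall w, Z r w @[r --> rho w] --> Z (rho w) w) ->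
  sigma_rv (fun w => Z (rho w) w) `<=` G.
Proof.
move=> sG t0 trho rhoG ZG cZ; apply/sigma_rvP => //.
pose k n w := Num.truncn (n.+1%:R * rho w).
pose grid n m : R := m.+1%:R / n.+1%:R.
pose rho_ n w := grid n (k n w).
have rho0 w : 0 <= rho w by exact: le_trans (trho w).
have kP n w : rho w < rho_ n w <= rho w + n.+1%:R^-1.
  have := truncn_itv (mulr_ge0 (ler0n R n.+1) (rho0 w)); rewrite -/(k n w).
  move=> /andP[k1 k2]; rewrite /rho_ /grid; apply/andP; split.
    by rewrite ltr_pdivlMr// mulrC.
  rewrite ler_pdivrMr// mulrDl mulVf// -natr1 lerD2r.
  by rewrite mulrC.
apply: (@measurable_fun_cvg _ (g_sigma_algebraType G) R setT
  (fun n w => Z (rho_ n w) w)).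
- move=> n _ B mB; rewrite setTI /measurable/= sigma_algebra_id//.
  have -> : (fun w => Z (rho_ n w) w) @^-1` B =
      \bigcup_m (k n @^-1` [set m] `&` Z (grid n m) @^-1` B).
    apply/seteqP; split => [w ZB|w [m _ [/= <-]]//].
    by exists (k n w).
  case: (sG) => G0 _ GU; apply: GU => m.
  have [tm|mt] := ltP t (grid n m).
    apply: sigma_algebra_setI => //.
      apply: rhoG; exists `[m%:R / n.+1%:R, grid n m[%classic.
        exact: measurable_itv.
      rewrite setTI; apply/seteqP; split => w /=; rewrite in_itv/=.
        rewrite ler_pdivrMr// ltr_pdivlMr// mulrC.
        exact: truncn_def.
      move=> <-; rewrite ler_pdivrMr// ltr_pdivlMr// mulrC.
      by apply: truncn_itv; rewrite mulr_ge0.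
    by apply: (ZG _ tm); exists B; rewrite ?setTI.
  (* A grid point not after [t] is never reached, being larger than [rho]. *)
  rewrite (_ : _ `&` _ = set0)//; apply/seteqP; split => // w [/= kw _].
  have /andP[+ _] := kP n w; rewrite /rho_ kw ltNge => /negP; apply.
  exact: le_trans (trho w).
move=> w _; apply: (cvg_comp (rho_^~ w) (fun r => Z r w)) (cZ w).
apply: (@squeeze_cvgr _ _ _ _ (cst (rho w)) (fun n => rho w + n.+1%:R^-1)).
- by near=> n; have /andP[/ltW -> ->] := kP n w.
- exact: cvg_cst.
- rewrite -[X in _ --> X]addr0; apply: cvgD; first exact: cvg_cst.
  exact: cvg_harmonic.
Unshelve. all: by end_near.
Qed.

End random_time.

(** * The information process *)

Section information_process_facts.
Context {d : measure_display} {T : measurableType d} {R : realType}.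
Variables (P : probability T R) (W : R -> T -> R).
Hypothesis W_BM : brownian_motion P W.
Variable tau : T -> R.
Hypotheses (mtau : measurable_fun setT tau) (tau_gt0 : forall w, 0 < tau w).
Hypothesis indep_tau_W : independent P (sigma_rv tau) (sigma_process `[0, +oo[ W).
Local Notation beta := (information_process tau W).
Local Notation G := (present_future_algebra W tau).
Local Notation G' := (future_time_algebra W tau).

Lemma bm_path_continuous w r : 0 < r -> {for r, continuous (W ^~ w)}.
Proof.
move=> r0; have cW := @bm_continuous _ _ _ _ _ W_BM w.
have [/(_ cW)[+ _] _] := continuous_within_itvcyP 0 (W ^~ w).
by apply; rewrite in_itv/= r0.
Qed.

Lemma future_time_increment t r : t <= r ->
  sigma_rv (future_increment W t r) `<=` G' t.
Proof.
rewrite le_eqVlt => /predU1P[<-|tr].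
  rewrite (_ : future_increment W t t = cst 0).
    by apply: sigma_rv_cst; exact: smallest_sigma_algebra.
  by apply/funext => w; rewrite /future_increment subrr.
apply: subset_trans (@sub_sigma_joinl _ _ _ _).
by apply: sub_sigma_process; rewrite /= in_itv/= andbT.
Qed.

Lemma sub_future_time t : G' t `<=` G t.
Proof. exact: sub_sigma_joinr. Qed.

Lemma present_future_bm t r : t <= r -> sigma_rv (W r) `<=` G t.
Proof.
move=> tr; apply: (sigma_rv_linear (X := W t) (Y := future_increment W t r)
  (a := 1) (b := 1)).
- exact: smallest_sigma_algebra.
- exact: sub_sigma_joinl.
- by apply: subset_trans (@sub_future_time t); exact: future_time_increment.
- by move=> w; rewrite /future_increment; ring.
Qed.

(** [beta u] involves the path only at [u] and at [rho = max (tau, u)].  The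
    quotient [W rho / rho] is obtained by evaluating the process [W r / r] at
    [rho], which makes [r] a constant as far as measurability is concerned. *)
Lemma information_present_future t u : 0 < t -> t <= u ->
  sigma_rv (beta u) `<=` G t.
Proof.
move=> t0 tu; have u0 := lt_le_trans t0 tu.
have sG : sigma_algebra setT (G t) by exact: smallest_sigma_algebra.
pose rho w := Num.max (tau w) u.
have urho w : u <= rho w by rewrite le_max lexx orbT.
apply: (sigma_rv_linear (X := W u)
  (Y := fun w => W (rho w) w / rho w) (a := 1) (b := - u)) => //.
- exact: present_future_bm.
- apply: (@sigma_rv_random_time _ _ _ _ (fun r w => W r w / r) rho t) => //.
  + exact: ltW.
  + by move=> w; exact: le_trans (urho w).
  + apply/sigma_rvP => //; apply: measurable_maxr => //.
    apply/sigma_rvP => //; apply: subset_trans (@sub_future_time t).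
    exact: sub_sigma_joinr.
  + move=> r tr; apply: (sigma_rv_linear (X := W r) (Y := W r)
      (a := r^-1) (b := 0)) => //.
    * by apply: present_future_bm; exact: ltW.
    * by apply: present_future_bm; exact: ltW.
    * by move=> w; rewrite mul0r addr0 mulrC.
  + move=> w; have r0 : 0 < rho w by exact: lt_le_trans (urho w).
    apply: cvgM; first exact: bm_path_continuous.
    by apply: cvgV; [rewrite gt_eqF|exact: cvg_id].
- by move=> w; rewrite /information_process -/(rho w) mul1r; ring.
Qed.

Lemma information0 w : beta 0 w = 0.
Proof. by rewrite /information_process mul0r mul0r subr0 (bm_start W_BM). Qed.

Lemma information_measurable u : 0 <= u -> measurable_fun setT (beta u).
Proof.
rewrite le_eqVlt => /predU1P[<-|u0].
  by rewrite (_ : beta 0 = cst 0)//; apply/funext => w; rewrite information0.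
apply: (@measurable_sigma_rv _ _ _ _ (G u)).
  by apply: (@present_future_algebra_measurable _ _ _ P) => //; exact: ltW.
exact: information_present_future.
Qed.

Lemma natural_information_measurable t :
  natural_filtration beta t `<=` measurable.
Proof.
apply: sigma_process_sub; first exact: sigma_algebra_measurable.
move=> s /=; rewrite in_itv/= => /andP[s0 _].
exact/sigma_rv_measurable/information_measurable.
Qed.

Lemma information_after_tau t w : 0 < t -> tau w <= t -> beta t w = 0.
Proof.
move=> t0 taut; rewrite /information_process.
have -> : Num.max (tau w) t = t by apply/max_idPr.
by rewrite divff ?gt_eqF// mul1r subrr.
Qed.

Lemma bm_atomless t x : 0 < t -> P (W t @^-1` [set x]) = 0%E.
Proof.
move=> t0; rewrite (bm_gaussian W_BM)//.
have /null_content_dominatesP := @normal_prob_dominates R 0 (Num.sqrt t).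
by apply => //; exact: lebesgue_measure_set1.
Qed.

(** For [t < tau], [beta t = 0] amounts to
    [W t = t / (tau - t) * (W tau - W t)]; the right-hand side depends on [tau]
    and on the increments after [t] only, hence is independent of [W t]. *)
Lemma information_zero_before_tau t : 0 < t ->
  P.-negligible [set w | t < tau w /\ beta t w = 0].
Proof.
move=> t0.
(* Any time after [t] would do where [tau <= t]; it keeps [rho - t] away from
   zero. *)
pose rho w := if t < tau w then tau w else t + 1.
have trho w : t < rho w by rewrite /rho; case: ifPn => // _; rewrite ltrDl.
pose c w := t / (rho w - t) * future_increment W t (rho w) w.
have sG' : sigma_algebra setT (G' t) by exact: smallest_sigma_algebra.
have G'm : G' t `<=` measurable.
  by apply: (@future_time_algebra_measurable _ _ _ P) => //; exact: ltW.
have cG' : sigma_rv c `<=` G' t.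
  apply: (@sigma_rv_random_time _ _ _ _
    (fun r w => t / (r - t) * future_increment W t r w) rho t) => //.
  - exact: ltW.
  - by move=> w; exact: ltW.
  - have mtau' : measurable_fun (setT : set (g_sigma_algebraType (G' t))) tau.
      by apply/sigma_rvP => //; exact: sub_sigma_joinr.
    by apply/sigma_rvP => //; apply: measurable_fun_ifT => //;
      exact: measurable_fun_ltr.
  - move=> r tr; apply: (sigma_rv_linear (X := future_increment W t r)
      (Y := future_increment W t r) (a := t / (r - t)) (b := 0)) => //.
    + by apply: future_time_increment; exact: ltW.
    + by apply: future_time_increment; exact: ltW.
    + by move=> w; rewrite mul0r addr0.
  - move=> w; apply: cvgM.
      apply: cvgM; first exact: cvg_cst.
      apply: cvgV; first by rewrite subr_eq0 gt_eqF.
      by apply: cvgB; [exact: cvg_id|exact: cvg_cst].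
    apply: cvgB; last exact: cvg_cst.
    by apply: bm_path_continuous; exact: lt_trans (trho w).
have mW : measurable_fun setT (W t) by apply: (bm_measurable W_BM); exact: ltW.
exists [set w | W t w = c w]; split.
- have mc : measurable_fun setT c by exact: measurable_sigma_rv cG'.
  rewrite (_ : [set w | _] = setT `&` (W t \- c) @^-1` [set 0]).
    by have := measurable_funB mW mc; apply.
  rewrite setTI; apply/seteqP; split => w /=; first by move=> ->; rewrite subrr.
  by move/eqP; rewrite subr_eq0 => /eqP.
- apply: (@independent_atomless_neq _ _ _ _ (G' t)) => //.
    by move=> x; exact: bm_atomless.
  apply: sub_independent
    (past_future_time_independent W_BM mtau indep_tau_W (ltW t0)).
    by apply: sub_natural_filtration; rewrite lexx ltW.
  by [].
- move=> w /= [ttau].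
  have tau0 := tau_gt0 w.
  rewrite /information_process /c /rho ttau max_l ?ltW// /future_increment.
  move/eqP; rewrite subr_eq0 => /eqP Wt.
  have d0 : tau w - t != 0 by rewrite subr_eq0 gt_eqF.
  have dtau : tau w != 0 by rewrite gt_eqF.
  rewrite Wt; field.
  by rewrite dtau d0.
Qed.

(** [beta t != 0] implies [tau > t], and then
    [beta s = brownian_bridge t s + s / t * beta t] for all [s <= t]: the events
    with a trace in the join form a sigma-algebra containing those of each
    [beta s]. *)
Lemma information_trace t A : 0 < t -> natural_filtration beta t A ->
  <<s bridge_algebra W t `|` sigma_rv (beta t) >>
    (A `&` [set w | beta t w != 0]).
Proof.
move=> t0; set K := <<s _ >>; set N := [set w | _].
have sK : sigma_algebra setT K by exact: smallest_sigma_algebra.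
have betaK : sigma_rv (beta t) `<=` K by exact: sub_sigma_joinr.
have KN : K N.
  apply: betaK; exists (~` [set 0]); first by apply: measurableC.
  by rewrite setTI; apply/seteqP; split => w /=; rewrite /N/= => /eqP.
pose H : set (set T) := [set B | K (B `&` N)].
suff : natural_filtration beta t `<=` H by apply.
apply: sigma_process_sub.
  split; rewrite /H/=.
  - by rewrite set0I; case: sK.
  - move=> B KB; rewrite setTD (_ : _ `&` _ = (setT `\` (B `&` N)) `&` N).
      apply: (sigma_algebra_setI sK) => //.
      by case: sK => _ KC _; exact: KC.
    by rewrite setTD setCI setIUl setICl setU0.
  - by move=> B KB; rewrite setI_bigcupl; case: sK => _ _; apply.
move=> s /=; rewrite in_itv/= => /andP[s0 st].
pose b w := brownian_bridge W t s w + s / t * beta t w.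
have bK : sigma_rv b `<=` K.
  apply: (sigma_rv_linear (X := brownian_bridge W t s) (Y := beta t) (a := 1)
    (b := s / t)) => //; last by move=> w; rewrite /b mul1r.
  move: s0; rewrite le_eqVlt => /predU1P[<-|s0].
    rewrite (_ : brownian_bridge W t 0 = cst 0); first exact: sigma_rv_cst.
    apply/funext => w.
    by rewrite /brownian_bridge mul0r mul0r subr0 (bm_start W_BM).
  move: st; rewrite le_eqVlt => /predU1P[->|st].
    rewrite (_ : brownian_bridge W t t = cst 0); first exact: sigma_rv_cst.
    apply/funext => w.
    by rewrite /brownian_bridge divff ?gt_eqF// mul1r subrr.
  apply: subset_trans (@sub_sigma_joinl _ _ _ _).
  by apply: sub_sigma_process; rewrite /= in_itv/= s0.
move=> _ [B mB <-]; rewrite /H/= setTI.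
have -> : beta s @^-1` B `&` N = b @^-1` B `&` N.
  have bE w : N w -> beta s w = b w.
    move=> Nw; have ttau : t < tau w.
      by rewrite ltNge; apply/negP => /(information_after_tau t0) /eqP; apply/negP.
    rewrite /b /brownian_bridge /information_process !max_l ?ltW//; last first.
      exact: le_lt_trans ttau.
    by field; rewrite !gt_eqF.
  by apply/seteqP; split => w /= [Bw Nw]; split => //; rewrite ?bE// -bE.
apply: (sigma_algebra_setI sK) => //.
by apply: bK; exists B; rewrite ?setTI.
Qed.

End information_process_facts.

(** * Integrals over a sub-sigma-algebra *)

Section integral_facts.
Context {d : measure_display} {T : measurableType d} {R : realType}.
Local Open Scope ereal_scope.

(** Here the integral is the difference of the integrals of the positive and
    negative parts, whether these are finite or not; both are monotone. *)
Lemma le_integral_measurable (mu : {measure set T -> \bar R}) (A : set T)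
    (f g : T -> \bar R) : measurable A ->
  measurable_fun A f -> measurable_fun A g -> (forall w, A w -> f w <= g w) ->
  \int[mu]_(w in A) f w <= \int[mu]_(w in A) g w.
Proof.
move=> mA mf mg fg; rewrite integralE [leRHS]integralE.
apply: leeB; apply: ge0_le_integral => //.
- exact: measurable_funepos.
- exact: measurable_funepos.
- by move=> w Aw; rewrite !funeposE ge_max le_max fg//= le_max lexx orbT.
- exact: measurable_funeneg.
- exact: measurable_funeneg.
- by move=> w Aw; rewrite !funenegE ge_max le_max leeN2 fg//= le_max lexx orbT.
Qed.

(** Outside [D] the restricted measure vanishes, and on subsets of [D] it is
    [mu]. *)
Lemma ge0_integral_mrestr (mu : {measure set T -> \bar R}) (A D : set T)
    (mD : measurable D) (f : T -> \bar R) : measurable A ->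
  measurable_fun A f -> (forall w, A w -> 0 <= f w) ->
  \int[mrestr mu mD]_(w in A) f w = \int[mu]_(w in A `&` D) f w.
Proof.
move=> mA mf f0; have mAD : measurable (A `&` D) by exact: measurableI.
have mADC : measurable (A `\` D) by exact: measurableD.
have dAD : [disjoint A `&` D & A `\` D] by apply/disj_setPS => w [[? ?] []].
have AE := setUIDK A D.
have := @ge0_integral_setU _ _ _ (mrestr mu mD) _ _ mAD mADC f.
rewrite AE => /(_ mf f0 dAD) ->.
rewrite [X in _ + X]null_set_integral ?adde0//.
- apply: eq_measure_integral => B mB BA /=; rewrite /mrestr setIidl//.
  by move=> w /BA[].
- by apply: measurable_funS mf => // w [].
- rewrite -[RHS](measure0 mu); congr (mu _).
  by rewrite -subset0 => w [[]].
Qed.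

Lemma lt_ereal_rat (y z : \bar R) : y < z -> exists pq : rat * rat,
  [/\ (pq.1 < pq.2)%R, y <= (ratr pq.1)%:E & (ratr pq.2)%:E <= z].
Proof.
move=> yz; have [a [b [ab ya bz]]] :
    exists a b : R, [/\ (a < b)%R, y <= a%:E & b%:E <= z].
  move: y z yz => [r| |] [s| |]//= rs.
  - by exists r, s; rewrite -lte_fin.
  - by exists r, (r + 1)%R; rewrite ltrDl leey.
  - by exists (s - 1)%R, s; rewrite gtrBl leNye.
  - by exists 0%R, 1%R; rewrite leNye leey.
have [p /[!in_itv]/= /andP[ap pb]] := rat_in_itvoo ab.
have [q /[!in_itv]/= /andP[pq qb]] := rat_in_itvoo pb.
exists (p, q) => /=; split.
- by rewrite -(ltr_rat R).
- by rewrite (le_trans ya)// lee_fin ltW.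
- by rewrite (le_trans _ bz)// lee_fin ltW.
Qed.

Variable P : probability T R.

(** For rationals [p < q], the event [Y <= p] and [q <= Z] belongs to [G]; the
    common integral over it is at most [p] times and at least [q] times its
    probability, which therefore vanishes.  Comparing with rationals makes the
    argument insensitive to infinite values and to infinite integrals. *)
Lemma negligible_lt_same_integrals (G : set (set T)) (Y Z : T -> \bar R) :
  sigma_algebra setT G -> G `<=` measurable ->
  sigma_rv Y `<=` G -> sigma_rv Z `<=` G ->
  (forall A, G A -> \int[P]_(w in A) Y w = \int[P]_(w in A) Z w) ->
  P.-negligible [set w | Y w < Z w].
Proof.
move=> sG Gm YG ZG YZ.
have mY : measurable_fun setT Y by exact: measurable_sigma_rv YG.
have mZ : measurable_fun setT Z by exact: measurable_sigma_rv ZG.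
pose A (pq : rat * rat) := [set w | Y w <= (ratr pq.1)%:E] `&`
  [set w | (ratr pq.2)%:E <= Z w].
have GA pq : G (A pq).
  apply: (sigma_algebra_setI sG).
    apply: YG; exists `]-oo, (ratr pq.1)%:E]%classic.
      exact: emeasurable_itv.
    by rewrite setTI; apply/seteqP; split => w /=; rewrite in_itv.
  apply: ZG; exists `[(ratr pq.2)%:E, +oo[%classic.
    exact: emeasurable_itv.
  by rewrite setTI; apply/seteqP; split => w /=; rewrite in_itv/= andbT.
have PA (pq : rat * rat) : (pq.1 < pq.2)%R -> P (A pq) = 0.
  move=> pq12; have mA := Gm _ (GA pq).
  have le1 : \int[P]_(w in A pq) Y w <= (ratr pq.1)%:E * P (A pq).
    rewrite -integral_cst//; apply: le_integral_measurable => //.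
      exact: measurable_funTS.
    by move=> w [].
  have le2 : (ratr pq.2)%:E * P (A pq) <= \int[P]_(w in A pq) Z w.
    rewrite -integral_cst//; apply: le_integral_measurable => //.
      exact: measurable_funTS.
    by move=> w [].
  have := le_trans le2 (le_trans _ le1); rewrite YZ// lexx => /(_ isT).
  have PAfin : P (A pq) = (fine (P (A pq)))%:E.
    by rewrite fineK// fin_num_measure.
  rewrite PAfin -!EFinM lee_fin -subr_ge0 -mulrBl => le3.
  have : (0 <= fine (P (A pq)))%R by exact: fine_ge0.
  rewrite le_eqVlt => /predU1P[<-//|PA0].
  by move: le3; rewrite pmulr_lge0// subr_ge0 ler_rat leNgt pq12.
pose F n := let pq := odflt (0%R, 0%R) (unpickle n : option (rat * rat)) in
  if (pq.1 < pq.2)%R then A pq else set0.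
apply: (@negligibleS _ _ _ _ (\bigcup_n F n)).
  move=> w /= /lt_ereal_rat[pq [pq12 Yp qZ]].
  exists (pickle pq); first exact: I.
  by rewrite /F pickleK /odflt /oapp pq12.
apply: negligible_bigcup => n; rewrite /F; case: ifPn => [pq12|_].
  by apply/negligibleP; [exact: Gm|exact: PA].
exact: negligible_set0.
Qed.

Lemma ae_eq_same_integrals (G : set (set T)) (Y Z : T -> \bar R) :
  sigma_algebra setT G -> G `<=` measurable ->
  sigma_rv Y `<=` G -> sigma_rv Z `<=` G ->
  (forall A, G A -> \int[P]_(w in A) Y w = \int[P]_(w in A) Z w) ->
  {ae P, forall w, Y w = Z w}.
Proof.
move=> sG Gm YG ZG YZ.
have YltZ := negligible_lt_same_integrals sG Gm YG ZG YZ.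
have ZltY := negligible_lt_same_integrals sG Gm ZG YG (fun A GA => esym (YZ A GA)).
apply: negligibleS (negligibleU YltZ ZltY) => w /= /eqP.
by rewrite neq_lt => /orP[]; [left|right].
Qed.

(** Integrating over [e `&` g] with [e] independent of [G] factorizes, because
    [P] restricted to [e] and [P e * P] agree on [G]. *)
Lemma ge0_independent_integral (E G : set (set T)) (e g : set T)
    (Z : T -> \bar R) : sigma_algebra setT G -> E `<=` measurable ->
  G `<=` measurable -> independent P E G -> E e -> G g ->
  sigma_rv Z `<=` G -> (forall w, 0 <= Z w) ->
  \int[P]_(w in e `&` g) Z w = P e * \int[P]_(w in g) Z w.
Proof.
move=> sG Em Gm EG Ee Gg ZG Z0.
have me := Em _ Ee; have mg := Gm _ Gg.
have mZ : measurable_fun setT Z by exact: measurable_sigma_rv ZG.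
pose S := g_sigma_algebraType G; pose p : T -> S := id.
have mSE (A : set S) : measurable A = G A.
  by rewrite /measurable/= sigma_algebra_id.
have mp : measurable_fun setT p by move=> _ B; rewrite mSE setTI => /Gm.
have mZS : measurable_fun setT (Z : S -> \bar R) by exact/sigma_rvP.
have pushE (m : {measure set T -> \bar R}) :
    \int[pushforward m p]_(w in g) Z w = \int[m]_(w in g) Z w.
  rewrite (ge0_integral_pushforward mp)//; first by rewrite mSE.
  exact: measurable_funTS.
rewrite setIC -ge0_integral_mrestr//; last exact: measurable_funTS.
pose c := NngNum (fine_ge0 (measure_ge0 P e)).
have cE : c%:num%:E = P e by rewrite /= fineK// fin_num_measure.
rewrite -cE -ge0_integral_mscale//; last exact: measurable_funTS.
rewrite -(pushE (mrestr P me)) -(pushE (mscale c P)).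
apply: eq_measure_integral => A; rewrite mSE => GA _.
by rewrite /= /pushforward /mrestr /mscale/= setIC EG// -cE.
Qed.

End integral_facts.

(** * Conditioning on a set where the past splits *)

Section integral_as_measure.
Context {d : measure_display} {T : measurableType d} {R : realType}.
Local Open Scope ereal_scope.
Variables (mu : {measure set T -> \bar R}) (X : T -> \bar R).
Hypotheses (mX : measurable_fun setT X) (X0 : forall w, 0 <= X w).

Let nu (A : set T) : \bar R := \int[mu]_(w in A) X w.
Let nu0 : nu set0 = 0. Proof. by rewrite /nu integral_set0. Qed.
Let nu_ge0 A : 0 <= nu A. Proof. exact: integral_ge0. Qed.
Let nu_sa : semi_sigma_additive nu.
Proof. by move=> F mF tF mUF; exact: semi_sigma_additive_nng_induced. Qed.

Lemma ge0_integral_as_measure : exists m : {measure set T -> \bar R},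
  forall A, m A = \int[mu]_(w in A) X w.
Proof.
pose nu_mixin := isMeasure.Build _ T R nu nu0 nu_ge0 nu_sa.
pose m : {measure set T -> \bar R} := HB.pack nu nu_mixin.
by exists m.
Qed.

End integral_as_measure.

Section conditioning_on_a_set.
Context {d : measure_display} {T : measurableType d} {R : realType}.
Local Open Scope ereal_scope.
Variables (P : probability T R) (E G B F : set (set T)) (N : set T).
Hypotheses (sE : sigma_algebra setT E) (sG : sigma_algebra setT G)
  (sB : sigma_algebra setT B) (sF : sigma_algebra setT F).
Hypotheses (Em : E `<=` measurable) (Gm : G `<=` measurable)
  (Fm : F `<=` measurable).
Hypotheses (EG : independent P E G) (BG : B `<=` G) (BF : B `<=` F) (BN : B N).
Hypothesis FN : forall A, F A -> <<s E `|` B >> (A `&` N).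

Let Bm : B `<=` measurable := subset_trans BG Gm.
Let mN : measurable N := Bm BN.

(** On a rectangle [e `&` b] independence gives both integrals the factor [P e];
    the other factors are integrals over [b `&` N], which belongs to [B].  The
    finite measures with densities [X] and [Y] thus agree on a pi-system. *)
Lemma join_integral_eq (X Y : T -> \bar R) :
  sigma_rv X `<=` G -> sigma_rv Y `<=` G ->
  (forall w, 0 <= X w) -> (forall w, 0 <= Y w) ->
  \int[P]_w X w < +oo ->
  (forall b, B b -> \int[P]_(w in b) X w = \int[P]_(w in b) Y w) ->
  forall A, <<s E `|` B >> A ->
  \int[P]_(w in A `&` N) X w = \int[P]_(w in A `&` N) Y w.
Proof.
move=> XG YG X0 Y0 Xoo XY.
have mX : measurable_fun setT X by exact: measurable_sigma_rv XG.
have mY : measurable_fun setT Y by exact: measurable_sigma_rv YG.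
have [mu1 mu1E] := ge0_integral_as_measure P mX X0.
have [mu2 mu2E] := ge0_integral_as_measure P mY Y0.
move=> A; rewrite (sigma_joinE sE sB) => KA; rewrite -mu1E -mu2E.
apply: (@measure_eq_pi_system _ _ _ _ (mrestr mu1 mN) (mrestr mu2 mN)) KA.
- exact: rectanglesI.
- exact: rectanglesT.
- by move=> _ [e [b [Ee Bb ->]]]; apply: measurableI; [exact: Em|exact: Bm].
- apply: le_lt_trans Xoo; rewrite -mu1E.
  by apply: le_measure; rewrite ?inE//; exact: measurableI.
move=> _ [e [b [Ee Bb ->]]]; rewrite [LHS]mu1E [RHS]mu2E -setIA.
have BbN : B (b `&` N) by exact: (sigma_algebra_setI sB).
have GbN := BG BbN.
rewrite (ge0_independent_integral sG Em Gm EG Ee GbN XG X0).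
by rewrite (ge0_independent_integral sG Em Gm EG Ee GbN YG Y0) XY.
Qed.

Definition has_common_condexp (X : T -> R) :=
  exists Y, [/\ is_condexp P F X Y & is_condexp P B X Y].

(** A version given [B] is corrected outside [N], where it is replaced by the
    constant value of [X]; then its integrals over [F] split along [N].  Being
    measurable for [B] and having the right integrals over the larger [F], it
    is a version for both. *)
Lemma common_condexp_integrable (X : T -> R) (c : R) :
  sigma_rv X `<=` G -> (forall w, (0 <= X w)%R) ->
  P.-integrable setT (EFin \o X) ->
  P.-negligible [set w | ~ N w /\ X w <> c] ->
  exists Y, [/\ is_condexp P F X Y, is_condexp P B X Y & forall w, 0 <= Y w].
Proof.
move=> XG X0 iX Xc0.
(* [c] may be negative if [N] has full measure. *)
pose c' := Num.max c 0%R.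
have Xc : P.-negligible [set w | ~ N w /\ X w <> c'].
  apply: negligibleS Xc0 => w [Nw Xw]; split => // Xwc; apply: Xw.
  by rewrite /c' -Xwc; apply/esym/max_idPl.
have mX : measurable_fun setT (EFin \o X) by exact: measurable_int iX.
have [w|Y0' [mY0' Y00 Y0E']] := exists_condexp_finite sB Bm _ iX.
  by rewrite lee_fin.
pose Y0 : T -> \bar R := Y0'.
have Y0B : sigma_rv Y0 `<=` B by exact/sigma_rvP.
have mY0 : measurable_fun setT Y0 by exact: measurable_sigma_rv Y0B.
have Y0E b : B b -> \int[P]_(w in b) Y0 w = \int[P]_(w in b) (X w)%:E.
  move=> Bb; rewrite -(Y0E' _ Bb).
  rewrite ge0_integral_pushforward//; last exact: measurable_funTS.
  by rewrite /measurable/= sigma_algebra_id.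
pose Y w := if w \in N then Y0 w else c'%:E.
have YB : sigma_rv Y `<=` B.
  apply/sigma_rvP => //.
  apply: measurable_fun_ifT; [|exact: mY0'|exact: measurable_cst].
  apply: (measurable_fun_bool true).
  rewrite setTI /measurable/= sigma_algebra_id// (_ : _ @^-1` _ = N)//.
  by apply/seteqP; split => w /=; [move/set_mem|move/mem_set].
have mY : measurable_fun setT Y by exact: measurable_sigma_rv YB.
have Y_ge0 w : 0 <= Y w.
  by rewrite /Y; case: ifPn => _; [exact: Y00|rewrite lee_fin /c' le_max lexx orbT].
have XGe : sigma_rv (EFin \o X) `<=` G.
  by apply/sigma_rvP => //; apply/measurable_EFinP; exact/sigma_rvP.
have Xoo : \int[P]_w (X w)%:E < +oo.
  have /integrableP[_] := iX; under eq_integral do rewrite gee0_abs ?lee_fin//.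
  by [].
have key := join_integral_eq XGe (subset_trans Y0B BG) _ Y00 Xoo.
have FE A : F A -> \int[P]_(w in A) Y w = \int[P]_(w in A) (X w)%:E.
  move=> FA; have mA := Fm FA.
  have split (Z : T -> \bar R) : measurable_fun setT Z -> (forall w, 0 <= Z w) ->
      \int[P]_(w in A) Z w =
      \int[P]_(w in A `&` N) Z w + \int[P]_(w in A `\` N) Z w.
    move=> mZ Z0; rewrite -ge0_integral_setU//= ?setUIDK//.
    - exact: measurableI.
    - exact: measurableD.
    - exact: measurable_funTS.
    - by apply/disj_setPS => w [[? ?] []].
  rewrite split// (split (EFin \o X))//; congr (_ + _).
    transitivity (\int[P]_(w in A `&` N) Y0 w).
      by apply: eq_integral => w /set_mem[_ Nw]; rewrite /Y mem_set.
    apply/esym; have := key _ _ _ (FN FA); rewrite -setIA setIid; apply => //.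
    by move=> b Bb; rewrite Y0E.
  apply: ae_eq_integral.
  - exact: measurableD.
  - exact: measurable_funTS.
  - exact: measurable_funTS.
  apply: negligibleS Xc => w /= /not_implyP[[_ Nw] YX]; split => // Xw; apply: YX.
  by rewrite /Y memNset// Xw.
exists Y; split => //; split => //; first exact: subset_trans BF.
by move=> b Bb; apply: FE; exact: BF.
Qed.

Lemma is_condexp_sum (H : set (set T)) (X : T -> R) (X_ : nat -> T -> R)
    (Y_ : nat -> T -> \bar R) : sigma_algebra setT H -> H `<=` measurable ->
  (forall n, measurable_fun setT (X_ n)) -> (forall n w, (0 <= X_ n w)%R) ->
  (forall w, (X w)%:E = \sum_(n <oo) (X_ n w)%:E) ->
  (forall n, is_condexp P H (X_ n) (Y_ n)) -> (forall n w, 0 <= Y_ n w) ->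
  is_condexp P H X (fun w => \sum_(n <oo) Y_ n w).
Proof.
move=> sH Hm mX X0 XE XY Y0; split.
  apply/sigma_rvP => //; apply: ge0_emeasurable_sum => // n _.
  by apply/sigma_rvP => //; have [] := XY n.
move=> A HA; have mA := Hm _ HA.
rewrite integral_nneseries//; last first.
  move=> n; apply: measurable_funTS; have [YH _] := XY n.
  exact: measurable_sigma_rv YH.
under eq_eseriesr => n _ do rewrite (XY n).2//.
rewrite -integral_nneseries//.
- by apply: eq_integral => w _; rewrite XE.
- by move=> n; apply: measurable_funTS; exact/measurable_EFinP.
- by move=> n w _; rewrite lee_fin.
Qed.

(** The integral of [X] may be infinite, so [X] is cut into the bounded pieces
    where [n <= X < n + 1]; each piece is a function of [X], hence satisfies the
    same assumptions, and nonnegative series commute with integrals. *)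
Lemma common_condexp_ge0 (X : T -> R) (c : R) :
  sigma_rv X `<=` G -> (forall w, (0 <= X w)%R) ->
  P.-negligible [set w | ~ N w /\ X w <> c] -> has_common_condexp X.
Proof.
move=> XG X0 Xc.
pose g n (x : R) : R := (x * \1_(`[n%:R, n.+1%:R[%classic : set R) x)%R.
have mg n : measurable_fun setT (g n) by exact: measurable_funM.
pose X_ n w := g n (X w).
have X_G n : sigma_rv (X_ n) `<=` G.
  apply/sigma_rvP => //; apply: (measurableT_comp (mg n)).
  exact/sigma_rvP.
have mX_ n : measurable_fun setT (X_ n) by exact: measurable_sigma_rv (X_G n).
have X_0 n w : (0 <= X_ n w)%R by rewrite mulr_ge0.
have X_c n : P.-negligible [set w | ~ N w /\ X_ n w <> g n c].
  by apply: negligibleS Xc => w [Nw Xw]; split => // /(congr1 (g n)).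
have iX_ n : P.-integrable setT (EFin \o X_ n).
  apply: (@le_integrable _ _ _ _ _ _ _ (cst n.+1%:R%:E)) => //; last first.
  - exact: finite_measure_integrable_cst.
  - move=> w _; rewrite /= !ger0_norm// lee_fin /X_ /g indicE.
    case: (boolP (_ \in _)) => [|_]; last by rewrite mulr0.
    by rewrite inE /= in_itv/= mulr1 => /andP[_ /ltW].
  - exact/measurable_EFinP.
have /choice[Y_ /all_and3[YF YB Y0]] n :=
  common_condexp_integrable (X_G n) (X_0 n) (iX_ n) (X_c n).
have XE w : (X w)%:E = \sum_(n <oo) (X_ n w)%:E.
  pose m := Num.truncn (X w).
  have /andP[m1 m2] := truncn_itv (X0 w).
  rewrite (nneseriesD1 (n := m))//=; last by move=> i _; rewrite lee_fin.
  rewrite eseries0 ?adde0.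
    by rewrite /X_ /g indicE mem_set ?mulr1//= in_itv/= m1.
  move=> i _ im; rewrite /X_ /g indicE memNset ?mulr0//= in_itv/= => /andP[i1 i2].
  by move/eqP: im; apply; apply/esym/truncn_def; rewrite i1.
exists (fun w => \sum_(n <oo) Y_ n w); split; exact: (is_condexp_sum (X_ := X_)).
Qed.

Lemma is_condexp_sub (H : set (set T)) (X X1 X2 : T -> R)
    (Y1 Y2 : T -> \bar R) : sigma_algebra setT H -> H `<=` measurable ->
  P.-integrable setT (EFin \o X1) -> P.-integrable setT (EFin \o X2) ->
  (forall w, X w = X1 w - X2 w)%R ->
  is_condexp P H X1 Y1 -> is_condexp P H X2 Y2 ->
  (forall w, 0 <= Y1 w) -> (forall w, 0 <= Y2 w) ->
  is_condexp P H X (Y1 \- Y2).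
Proof.
move=> sH Hm iX1 iX2 XE [Y1H YE1] [Y2H YE2] Y10 Y20.
have HT := sigma_algebra_setT sH.
have integrable_version (X' : T -> R) (Y : T -> \bar R) :
    P.-integrable setT (EFin \o X') -> sigma_rv Y `<=` H ->
    (forall w, 0 <= Y w) ->
    (forall A, H A -> \int[P]_(w in A) Y w = \int[P]_(w in A) (X' w)%:E) ->
    P.-integrable setT Y.
  move=> iX' YH Y0 YE; apply/integrableP; split.
    exact: measurable_sigma_rv YH.
  under eq_integral do rewrite gee0_abs//.
  by rewrite YE// ltey_eq integrable_fin_num.
have iY1 := integrable_version _ _ iX1 Y1H Y10 YE1.
have iY2 := integrable_version _ _ iX2 Y2H Y20 YE2.
split.
  by apply/sigma_rvP => //; apply: emeasurable_funB; exact/sigma_rvP.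
move=> A HA; have mA := Hm _ HA.
rewrite integralB//; [|exact: integrableS iY1|exact: integrableS iY2].
rewrite YE1// YE2// -integralB//.
- by apply: eq_integral => w _; rewrite XE EFinB.
- exact: integrableS iX1.
- exact: integrableS iX2.
Qed.

(** The positive and negative parts of an integrable [X] are treated apart. *)
Lemma common_condexp (X : T -> R) (c : R) :
  sigma_rv X `<=` G ->
  (forall w, (0 <= X w)%R) \/ P.-integrable setT (EFin \o X) ->
  P.-negligible [set w | ~ N w /\ X w <> c] -> has_common_condexp X.
Proof.
move=> XG [X0|iX] Xc; first exact: common_condexp_ge0 XG X0 Xc.
pose g1 (x : R) : R := Num.max x 0%R; pose g2 (x : R) : R := Num.max (- x)%R 0%R.
have part (g : R -> R) : measurable_fun setT g ->
    (forall x, 0 <= g x <= `|x|)%R ->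
    exists Y, [/\ is_condexp P F (g \o X) Y, is_condexp P B (g \o X) Y,
      (forall w, 0 <= Y w) & P.-integrable setT (EFin \o (g \o X))].
  move=> mg g0.
  have gXG : sigma_rv (g \o X) `<=` G.
    by apply/sigma_rvP => //; apply: (measurableT_comp mg); exact/sigma_rvP.
  have gX0 w : (0 <= (g \o X) w)%R by have /andP[] := g0 (X w).
  have igX : P.-integrable setT (EFin \o (g \o X)).
    apply: le_integrable iX => //.
      by apply/measurable_EFinP; exact: measurable_sigma_rv gXG.
    by move=> w _; rewrite /= lee_fin ger0_norm//; have /andP[] := g0 (X w).
  have gXc : P.-negligible [set w | ~ N w /\ (g \o X) w <> g c].
    by apply: negligibleS Xc => w [Nw Xw]; split => // Xwc; apply: Xw; rewrite /= Xwc.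
  have [Y [? ? ?]] := common_condexp_integrable gXG gX0 igX gXc.
  by exists Y.
have [||Y1 [YF1 YB1 Y10 iX1]] := part g1.
- exact: measurable_maxr.
- by move=> x; rewrite /g1 ge_max le_max lexx orbT normr_ge0 ler_norm.
have [||Y2 [YF2 YB2 Y20 iX2]] := part g2.
- exact: measurable_maxr.
- move=> x; rewrite /g2 ge_max le_max lexx orbT normr_ge0.
  by rewrite -(normrN x) ler_norm.
have XE w : X w = ((g1 \o X) w - (g2 \o X) w)%R.
  rewrite /= /g1 /g2; have [x0|x0] := leP 0%R (X w).
    by rewrite max_r ?subr0// oppr_le0.
  by rewrite max_l ?oppr_ge0 ?sub0r ?opprK// ltW.
exists (Y1 \- Y2); split.
- exact: is_condexp_sub iX1 iX2 XE YF1 YF2 Y10 Y20.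
- exact: is_condexp_sub iX1 iX2 XE YB1 YB2 Y10 Y20.
Qed.

Lemma common_condexp_ae_eq (X : T -> R) : measurable_fun setT X ->
  (forall w, (0 <= X w)%R) \/ P.-integrable setT (EFin \o X) ->
  has_common_condexp X ->
  {ae P, forall w, condexp P F X w = condexp P B X w}.
Proof.
move=> mX hX [Y [[YF YFE] [YB YBE]]].
have [FYm FYE] := condexpP sF Fm mX hX.
have [BYm BYE] := condexpP sB Bm mX hX.
have F_Y : {ae P, forall w, condexp P F X w = Y w}.
  by apply: ae_eq_same_integrals sF Fm FYm YF _ => A FA; rewrite FYE// YFE.
have B_Y : {ae P, forall w, condexp P B X w = Y w}.
  by apply: ae_eq_same_integrals sB Bm BYm YB _ => A BA; rewrite BYE// YBE.
by apply: filterS2 F_Y B_Y => w -> ->.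
Qed.

End conditioning_on_a_set.

(** * The Markov property *)

Lemma natural_filtration0 (d : measure_display) (T : measurableType d)
  (R : realType) (X : R -> T -> R) : natural_filtration X 0 = sigma_rv (X 0).
Proof.
rewrite /natural_filtration /sigma_process set_itv1 bigcup_set1.
by apply: sigma_algebra_id; exact: sigma_algebra_sigma_rv.
Qed.

Theorem theorem3p1 (d : measure_display) (T : measurableType d) (R : realType)
    (P : probability T R) (complete_P : measure_is_complete P)
    (W : R -> T -> R) (W_BM : brownian_motion P W)
    (tau : {RV P >-> R}) (tau_gt0 : forall w, 0 < tau w)
    (indep_tau_W : independent P (sigma_rv tau) (sigma_process `[0, +oo[ W))
    (tau_not_stopping :
      ~ stopping_time (completed_natural_filtration P W) tau)
    (t h : R) (t_ge0 : 0 <= t) (h_ge0 : 0 <= h)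
    (f : R -> R) (mf : measurable_fun setT f) :
  let beta := information_process tau W in
  (forall x, 0 <= f x) \/
    P.-integrable setT (EFin \o (f \o beta (t + h))) ->
  {ae P, forall w,
    condexp P (natural_filtration beta t) (f \o beta (t + h)) w =
    condexp P (sigma_rv (beta t)) (f \o beta (t + h)) w}.
Proof.
move=> beta f_cond.
have mtau : measurable_fun setT tau by exact: measurable_funP.
have th0 : 0 <= t + h by rewrite addr_ge0.
have mX : measurable_fun setT (f \o beta (t + h)).
  by apply: (measurableT_comp mf); exact: (information_measurable W_BM mtau).
move: t_ge0; rewrite le_eqVlt => /predU1P[<-|t0].
  by rewrite natural_filtration0; exact: aeW.
have hX : (forall w, 0 <= (f \o beta (t + h)) w) \/
    P.-integrable setT (EFin \o (f \o beta (t + h))).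
  by case: f_cond => [f0|]; [left => w; exact: f0|right].
pose E := bridge_algebra W t; pose G := present_future_algebra W tau t.
pose B := sigma_rv (beta t); pose F := natural_filtration beta t.
pose N := [set w | beta t w != 0].
have sE : sigma_algebra setT E by exact: smallest_sigma_algebra.
have sG : sigma_algebra setT G by exact: smallest_sigma_algebra.
have sF : sigma_algebra setT F by exact: smallest_sigma_algebra.
have sB : sigma_algebra setT B by exact: sigma_algebra_sigma_rv.
have Em : E `<=` measurable.
  apply: subset_trans (natural_filtration_measurable W_BM (t := t)).
  exact: bridge_algebra_sub.
have Gm : G `<=` measurable.
  exact: (present_future_algebra_measurable W_BM mtau (ltW t0)).
have Fm : F `<=` measurable by exact: (natural_information_measurable W_BM mtau).
have EG : independent P E G by exact: bridge_present_future_independent.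
have BG : B `<=` G by exact: (information_present_future W_BM t0 (lexx t)).
have BF : B `<=` F.
  by apply: sub_sigma_process; rewrite /= in_itv/= lexx ltW.
have BN : B N.
  exists (~` [set 0]); first exact: measurableC.
  by rewrite setTI; apply/seteqP; split => w /=; rewrite /N/= => /eqP.
have XG : sigma_rv (f \o beta (t + h)) `<=` G.
  apply/sigma_rvP => //; apply: (measurableT_comp mf); apply/sigma_rvP => //.
  by apply: (information_present_future W_BM t0); rewrite lerDl.
apply: (common_condexp_ae_eq sB sF Gm Fm BG) => //.
apply: (@common_condexp _ _ _ P E G B F N sE sG sB sF Em Gm Fm EG BG BF BN _
  (f \o beta (t + h)) (f 0)) => //.
  by move=> A; exact: (information_trace W_BM tau_gt0 t0).
apply: negligibleS
  (information_zero_before_tau W_BM mtau tau_gt0 indep_tau_W t0) => w /=.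
move=> [/negP/negPn/eqP betat0 fneq]; split => //.
rewrite ltNge; apply/negP => taut; apply: fneq; congr f.
by apply: information_after_tau; [exact: ltr_wpDr|rewrite (le_trans taut)// lerDl].
Qed.
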